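(* Let $p$ be a prime, let $N>1$ be an integer prime to $p$, and let $N=l_1^{k_1}\cdots l_n^{k_n}$ be its prime factorization. Fix an integer $r$. For a primitive Dirichlet character $\chi$ (with values in $\overline{\mathbb{Q}}_p$) of conductor $f_\chi$ with $f_\chi\mid N$, put \[ L_r(\chi)= \begin{cases} \prod_i\left(1-\chi(l_i)l_i^{-r}\right) L_p(r,\chi\omega^{1-r}), & f_\chi>1,\\[2pt] \left(\prod_i(1-l^{-r}_i)-N^{1-r}\prod_i(1-l_i^{-1})\right)L_p(r,\omega^{1-r}), & f_\chi=1,\ r\neq 1,\\[2pt] \prod_i(1-l_i^{-1})\left(\sum_i\frac{p^{-1}\log(l^{p-1}_i)}{l_i-1}+p^{-1}\log(N^{p-1})\right), & f_\chi=1,\ r=1. \end{cases} \] Then for every integer $k$ with $0<k<N$ and $\gcd(k,N)=1$, \[ \widetilde{\psi}^{(r-1)}_p(k/N)=-\frac{N^r}{\varphi(N)}\sum_{\chi}\chi(k)^{-1}L_r(\chi), \] where $\chi$ runs over all primitive Dirichlet characters whose conductor $f_\chi$ divides $N$, and $\varphi$ is Euler's totient function.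
   Context: For an integer $r$, $\widetilde{\psi}_p^{(r)}(z):=\lim_{n\in\mathbb{Z}_{>0},\,n\to z}\sum_{0<k<n,\ p\nmid k}k^{-(r+1)}$ for $z\in\mathbb{Z}_p$ (the $p$-adic polygamma function). $\omega$ is the Teichmüller character, $L_p(s,\chi)$ the Kubota–Leopoldt $p$-adic $L$-function, and $\log:1+p\mathbb{Z}_p\to p\mathbb{Z}_p$ the $p$-adic logarithm. The trivial character is the unique primitive character with $f_\chi=1$. *)

(* Defs.v *)
From HB Require Import structures.
From mathcomp Require Import all_boot all_order all_algebra.
From mathcomp Require Import all_classical all_reals.

Set Implicit Arguments.
Unset Strict Implicit.
Unset Printing Implicit Defensive.

Import Order.TTheory GRing.Theory Num.Theory.

Local Open Scope classical_set_scope.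
Local Open Scope ring_scope.

Definition tends_to (R : realType) (K : zmodType) (nu : K -> R)
    (u : nat -> K) (l : K) : Prop :=
  forall e : R, 0 < e -> exists m : nat,
    forall n : nat, (m <= n)%N -> nu (u n - l) < e.

Definition cauchy_seq (R : realType) (K : zmodType) (nu : K -> R)
    (u : nat -> K) : Prop :=
  forall e : R, 0 < e -> exists m : nat,
    forall i j : nat, (m <= i)%N -> (m <= j)%N -> nu (u i - u j) < e.

(* The topological closure of the prime field of K; this is Q_p as soon as nu
   restricts to the p-adic absolute value on the rationals and their Cauchy
   sequences converge. *)
Definition closure_of_rat (R : realType) (K : fieldType) (nu : K -> R)
    (x : K) : Prop :=
  forall e : R, 0 < e -> exists q : rat, nu (x - ratr q) < e.

(* An algebraic closure of Q_p with its p-adic absolute value: an algebraically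
   closed field with a non-archimedean absolute value normalised by |p| = 1/p
   (which forces characteristic 0 when p is prime), in which the closure of the
   rationals is complete, hence is Q_p, and over that closure every element is
   algebraic.  This determines the valued field up to isomorphism. *)
Record padic_closure (R : realType) (p : nat) := PadicClosure {
  padic_field :> closedFieldType;
  pnorm : padic_field -> R;
  pnorm_ge0 : forall x, 0 <= pnorm x;
  pnorm_eq0 : forall x, pnorm x = 0 <-> x = 0;
  pnormM : forall x y, pnorm (x * y) = pnorm x * pnorm y;
  pnormD : forall x y, pnorm (x + y) <= Num.max (pnorm x) (pnorm y);
  pnorm_p : pnorm p%:R = p%:R^-1;
  Qp_complete : forall u : nat -> rat,
    cauchy_seq pnorm (fun n => ratr (u n)) ->
    exists l, tends_to pnorm (fun n => ratr (u n)) l;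
  Qp_algebraic : forall x, exists P : {poly padic_field},
    [/\ P != 0, forall i, closure_of_rat pnorm P`_i & root P x]
}.

Section Padic.
Variables (R : realType) (p : nat) (K : padic_closure R p).

(* Z_p is the closure of the integers. *)
Definition in_Zp (x : K) : Prop :=
  forall e : R, 0 < e -> exists a : int, pnorm (x - a%:~R) < e.

Definition plim (u : nat -> K) : K := xget 0 [set l | tends_to (@pnorm R p K) u l].

Definition plog (x : K) : K :=
  plim (fun m => \sum_(1 <= j < m.+1) (-1) ^+ j.+1 * (x - 1) ^+ j / j%:R).

(* Limit of F n as the positive integer n tends p-adically to z. *)
Definition nat_tends_to (F : nat -> K) (z l : K) : Prop :=
  forall e : R, 0 < e -> exists2 d : R, 0 < d &
    forall n : nat, (0 < n)%N -> pnorm (n%:R - z : K) < d -> pnorm (F n - l) < e.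

Definition polygamma (r : int) (z : K) : K :=
  xget 0 [set l | nat_tends_to
    (fun n => \sum_(1 <= k < n | ~~ (p %| k)%N) k%:R ^ (- (r + 1))) z l].

(* Dirichlet characters are represented by their values on natural numbers. *)
Definition dirichlet_character (f : nat) (chi : nat -> K) : Prop :=
  [/\ (0 < f)%N,
      chi 1%N = 1,
      forall a b, chi (a * b)%N = chi a * chi b,
      forall a, chi (a + f)%N = chi a &
      forall a, (chi a != 0) = coprime a f].

(* chi is primitive modulo f: it does not factor through a proper divisor d. *)
Definition primitive_mod (f : nat) (chi : nat -> K) : Prop :=
  dirichlet_character f chi /\
  forall d : nat, (d %| f)%N ->
    (forall a, coprime a f -> a = 1 %[mod d] -> chi a = 1) -> d = f.

Definition primitive_character (chi : nat -> K) : Prop :=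
  exists f, primitive_mod f chi.

(* Only meaningful for a primitive chi; f is then unique. *)
Definition conductor (chi : nat -> K) : nat :=
  xget 0%N [set f | primitive_mod f chi].

Definition teichmuller_modulus : nat := if p == 2%N then 4%N else p.

(* omega(a) is the root of unity of order dividing phi(q) congruent to a
   modulo q, where q = p for odd p and q = 4 for p = 2. *)
Definition teichmuller (a : nat) : K :=
  let q := teichmuller_modulus in
  if (p %| a)%N then 0 else
  xget 0 [set w | w ^+ totient q = 1 /\ pnorm (w - a%:R) <= pnorm (q%:R : K)].

(* The primitive character chi omega^m: as usual, the product of primitive
   characters is the primitive character which induces the pointwise product.
   In particular its value at p is nonzero when omega^m is trivial and p does
   not divide the conductor of chi. *)
Definition teichmuller_twist (chi : nat -> K) (m : int) : nat -> K :=
  xget (fun=> 0) [set theta | primitive_character theta /\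
    forall a, coprime a (p * conductor chi)%N ->
      theta a = chi a * teichmuller a ^ m].

(* bernoullis n = [:: B_0; ...; B_n], with B_1 = -1/2 *)
Fixpoint bernoullis (n : nat) : seq rat :=
  if n is n'.+1 then
    let s := bernoullis n' in
    rcons s (- (n'.+2)%:R^-1 * \sum_(k < n'.+1) 'C(n'.+2, k)%:R * s`_k)
  else [:: 1].

Definition bernoulli (n : nat) : rat := (bernoullis n)`_n.

Definition bernoulli_poly (n : nat) : {poly rat} :=
  \sum_(k < n.+1) ('C(n, k)%:R * bernoulli k) *: 'X^(n - k).

(* B_{n,chi}, i.e. n! times the coefficient of t^n in
   \sum_(1 <= a <= f) chi(a) t e^(a t) / (e^(f t) - 1), f the conductor. *)
Definition generalized_bernoulli (chi : nat -> K) (n : nat) : K :=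
  let f := conductor chi in
  f%:R ^ (n%:Z - 1) *
  \sum_(1 <= a < f.+1) chi a * ratr (bernoulli_poly n).[a%:R / f%:R].

(* L restricted to Z_p (to Z_p minus 1 when psi is trivial) is the
   Kubota-Leopoldt function s |-> L_p(s, psi), i.e. the unique continuous
   function on that set with
     L_p(1 - n, psi) = - (1 - theta(p) p^(n-1)) B_{n,theta} / n,
     theta = psi omega^(-n),
   for all n >= 1; the values of L elsewhere are irrelevant. *)
Definition is_kubota_leopoldt (psi : nat -> K) (L : K -> K) : Prop :=
  let D s := in_Zp s /\ (conductor psi = 1%N -> s <> 1) in
  (forall s, D s -> forall e : R, 0 < e -> exists2 d : R, 0 < d &
     forall t, D t -> pnorm (t - s) < d -> pnorm (L t - L s) < e) /\
  (forall n : nat, (0 < n)%N ->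
     let theta := teichmuller_twist psi (- n%:Z) in
     L (1 - n%:R) =
       - ((1 - theta p * p%:R ^ (n%:Z - 1)) * generalized_bernoulli theta n
            / n%:R)).

Definition trivial_character : nat -> K := fun=> 1.

Definition L_value (Lp : (nat -> K) -> K -> K) (N : nat) (r : int)
    (chi : nat -> K) : K :=
  if conductor chi != 1%N then
    \prod_(l <- primes N) (1 - chi l * l%:R ^ (- r)) *
    Lp (teichmuller_twist chi (1 - r)) r%:~R
  else if r != 1 then
    (\prod_(l <- primes N) (1 - l%:R ^ (- r)) -
     N%:R ^ (1 - r) * \prod_(l <- primes N) (1 - l%:R^-1)) *
    Lp (teichmuller_twist trivial_character (1 - r)) r%:~R
  else
    \prod_(l <- primes N) (1 - l%:R^-1) *
    (\sum_(l <- primes N) (p%:R^-1 * plog (l%:R ^+ p.-1)) / (l%:R - 1) +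
     p%:R^-1 * plog (N%:R ^+ p.-1)).

End Padic.

Lemma size_bernoullis n : size (bernoullis n) = n.+1.
Proof. by elim: n => //= n IHn; rewrite size_rcons IHn. Qed.

Lemma nth_bernoullis n k : (k <= n)%N -> (bernoullis n)`_k = bernoulli k.
Proof.
elim: n => [|n IHn]; first by rewrite leqn0 => /eqP ->.
rewrite leq_eqVlt => /predU1P[-> //|kn].
by rewrite /= nth_rcons size_bernoullis kn IHn.
Qed.

Lemma sum_bernoulli n :
  \sum_(k < n.+1) 'C(n.+1, k)%:R * bernoulli k = (n == 0%N)%:R.
Proof.
case: n => [|n]; first by rewrite big_ord1 mulr1.
rewrite big_ord_recr /= /bernoulli /= nth_rcons size_bernoullis ltnn eqxx.
rewrite binSn mulNr mulrN mulVKf ?pnatr_eq0 //; apply/eqP; rewrite subr_eq0.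
by apply/eqP/eq_bigr => k _; rewrite [in RHS]nth_bernoullis; last by rewrite -ltnS ltn_ord.
Qed.

(* Main.v *)
(* For r = 1 - n with n >= 1, the sum of the j^(n-1) over 0 < j < m prime to
   p is a polynomial expression in m and m' = ceil(m / p), through the Bernoulli
   polynomial B_n.  When m tends to k / N, m' tends to k' / N, where 0 < k' < N
   and p k' = k modulo N, so the limit is
     (B_n(k/N) - p^(n-1) B_n(k'/N) - (1 - p^(n-1)) B_n) / n.
   Removing the Euler factors at the primes dividing N turns the right-hand
   side into sums of chi(a) B_n(a/N) over a prime to N, and orthogonality of
   characters yields the same value.  The general case follows by letting n
   tend to 1 - r p-adically, with n = 1 - r modulo the order of the Teichmuller
   character: the power sums converge uniformly in m, and each term on the
   right is continuous.  For r = 1 and chi = 1, where the p-adic L-function has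
   its pole, the factor in front of it vanishes, and the limit is found from
   (a^n - 1) / n -> log a and (1 - p^(n-1)) B_n -> 1 - 1/p as n -> 0. *)
Require Import Defs.
From HB Require Import structures.
From mathcomp Require Import all_boot all_order all_algebra.
From mathcomp Require Import all_fingroup all_solvable all_field all_character.
From mathcomp Require Import finmap.
From mathcomp Require Import all_classical all_reals.
From mathcomp Require Import ring lra zify.

Set Implicit Arguments.
Unset Strict Implicit.
Unset Printing Implicit Defensive.

Import Order.TTheory GRing.Theory Num.Theory.
Local Open Scope classical_set_scope.
Local Open Scope ring_scope.

(** * Bernoulli polynomials *)

(** The p-adic L-functions are known only through their values at [1 - n], where the character
    carries [omega^(-n)]. Keeping n in the class of 1 - r modulo the order of [omega] makes this
    twist cancel [omega^(1-r)], so that the finite identities involve chi itself and classical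
    numbers [B_{n,chi}]. The term [(1 - p^(n-1)) B_n] does not depend on k, hence belongs to the
    trivial character alone: it is the source of the extra [N^(1-r) prod (1 - 1/l) = N^(-r) phi(N)]
    in the case of conductor 1. An algebraic closure of Q_p is not complete; only Cauchy sequences
    of rationals are known to converge. This shapes two constructions: Teichmuller representatives
    are found among the roots of [X^(p-1) - 1] rather than by Hensel's lemma, and logarithms are
    taken only of natural numbers. *)

Lemma deriv_eq0_const (F : numDomainType) (P : {poly F}) :
  P^`() = 0 -> P = (P.[0])%:P.
Proof.
move=> P0; apply/polyP => -[|i]; rewrite coefC /= ?horner_coef0 //.
have /eqP := congr1 (fun Q : {poly F} => Q`_i) P0.
by rewrite coef_deriv coef0 mulrn_eq0 => /eqP.
Qed.

Lemma horner_bernoulli_poly n x : (bernoulli_poly n).[x] =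
  \sum_(k < n.+1) 'C(n, k)%:R * bernoulli k * x ^+ (n - k).
Proof.
by rewrite /bernoulli_poly horner_sum; apply: eq_bigr => k _; rewrite !hornerE.
Qed.

Lemma bernoulli_poly0 n : (bernoulli_poly n).[0] = bernoulli n.
Proof.
rewrite horner_bernoulli_poly big_ord_recr /= subnn expr0 binn mul1r mulr1.
rewrite big1 ?add0r // => k _.
by rewrite expr0n subn_eq0 leqNgt ltn_ord mulr0.
Qed.

Lemma bernoulli_poly1 n : (bernoulli_poly n).[1] = bernoulli n + (n == 1)%:R.
Proof.
rewrite horner_bernoulli_poly big_ord_recr /= binn mul1r expr1n mulr1 addrC.
congr (_ + _); under eq_bigr do rewrite expr1n mulr1.
by case: n => [|n]; rewrite ?big_ord0 // sum_bernoulli.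
Qed.

Lemma deriv_bernoulli_poly n :
  (bernoulli_poly n.+1)^`() = n.+1%:R *: bernoulli_poly n.
Proof.
rewrite /bernoulli_poly big_ord_recr /= subnn expr0 derivD derivZ derivC.
rewrite scaler0 addr0 raddf_sum scaler_sumr /=; apply: eq_bigr => k _.
have kn : (k <= n)%N by rewrite -ltnS.
rewrite derivZ derivXn subSn //= -scalerMnr -scaler_nat !scalerA.
congr (_ *: _); rewrite !mulrA -!natrM.
by rewrite (mul_bin_down n.+1) subSn //.
Qed.

Lemma bernoulli_poly_diff n x :
  (bernoulli_poly n).[x + 1] - (bernoulli_poly n).[x] = n%:R * x ^+ n.-1.
Proof.
suff H : bernoulli_poly n \Po ('X + 1) - bernoulli_poly n
         = n%:R *: 'X^(n.-1) :> {poly rat}.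
  have := congr1 (fun P : {poly rat} => P.[x]) H.
  by rewrite !hornerE horner_comp !hornerE.
elim: n => [|n IHn].
  rewrite /bernoulli_poly big_ord1 subnn expr0 scale0r linearZ /=.
  by rewrite -polyC1 comp_polyC subrr.
apply/eqP; rewrite -subr_eq0; apply/eqP.
set Q := LHS; have : Q^`() = 0.
  rewrite /Q !derivE deriv_comp !derivE addr0 mulr1 deriv_bernoulli_poly linearZ /=.
  by rewrite -scalerBr IHn /= -scaler_nat subrr.
move=> /deriv_eq0_const ->; rewrite /Q !hornerE horner_comp !hornerE.
rewrite bernoulli_poly1 bernoulli_poly0 /= expr0n eqSS [_ + (_)%:R]addrC addrK.
by case: (n) => [|m] /=; rewrite ?mulr1 ?mulr0 ?subrr.
Qed.

Lemma sum_exprn_bernoulli n m : n%:R * (\sum_(0 <= j < m) j%:R ^+ n.-1) =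
  (bernoulli_poly n).[m%:R] - bernoulli n.
Proof.
elim: m => [|m IHm]; first by rewrite big_nil mulr0 bernoulli_poly0 subrr.
rewrite big_nat_recr //= mulrDr IHm -bernoulli_poly_diff natr1.
by rewrite addrC addrA subrK.
Qed.

(** The defect D_n of the relation satisfies [D_{n+1}' = (n+1) D_n] and [D_n(1) = D_n(0)]. If D_m =
    0, then D_{m+1} is a constant c and D_{m+2} is affine of slope (m+2) c, so equality of its
    values at 0 and 1 forces c = 0. *)
Lemma bernoulli_poly_distribution n (M : nat) x : (0 < M)%N ->
  M%:R ^+ n * (\sum_(i < M) (bernoulli_poly n).[(x + i%:R) / M%:R]) =
  M%:R * (bernoulli_poly n).[x].
Proof.
move=> M_gt0; have M0 : M%:R != 0 :> rat by rewrite pnatr_eq0 -lt0n.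
pose D n : {poly rat} := M%:R ^+ n *:
  (\sum_(i < M) (bernoulli_poly n \Po (M%:R^-1 *: ('X + (i%:R)%:P)))) -
  M%:R *: bernoulli_poly n.
have Dx m y : (D m).[y] = M%:R ^+ m *
    (\sum_(i < M) (bernoulli_poly m).[(y + i%:R) / M%:R]) -
    M%:R * (bernoulli_poly m).[y].
  rewrite !hornerE horner_sum; congr (_ * _ - _); apply: eq_bigr => i _.
  by rewrite horner_comp !hornerE mulrC.
have D' m : (D m.+1)^`() = m.+1%:R *: D m.
  rewrite derivB !derivZ raddf_sum deriv_bernoulli_poly scalerBr /=.
  congr (_ - _); last by rewrite !scalerA mulrC.
  rewrite !scaler_sumr; apply: eq_bigr => i _.
  rewrite deriv_comp deriv_bernoulli_poly !derivE addr0 linearZ /= alg_polyC.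
  rewrite mulrC mul_polyC !scalerA; congr (_ *: _).
  by rewrite exprS; field.
(* The two sums combine into a telescoping one. The difference is [(M^m - M) (B_m(1) - B_m(0))],
   whose second factor is nonzero only for m = 1, where the first one vanishes. *)
have D01 m : (D m).[1] = (D m).[0].
  apply/eqP; rewrite -subr_eq0 !Dx.
  under eq_bigr do rewrite addrC natr1.
  under [in X in _ - X]eq_bigr do rewrite add0r.
  rewrite opprD opprK addrACA [X in _ + X]addrC -mulrBr -mulrBr.
  rewrite -!(big_mkord predT (fun i => (bernoulli_poly m).[i%:R / M%:R])).
  rewrite -(big_mkord predT (fun i => (bernoulli_poly m).[i.+1%:R / M%:R])).
  rewrite -sumrB telescope_sumr // divff // mul0r.
  rewrite bernoulli_poly1 bernoulli_poly0 opprD addrA subrr add0r.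
  by apply/eqP; case: m => [|[|m]] /=; ring.
have D_0 : D 0%N = 0.
  rewrite /D /bernoulli_poly expr0 scale1r big_ord1 /= expr0 scale1r.
  under eq_bigr do rewrite -polyC1 comp_polyC.
  by rewrite sumr_const card_ord -scaler_nat subrr.
clearbody D; suff D0 m : D m = 0 by apply/eqP; rewrite -subr_eq0 -Dx D0 horner0.
elim: m => [//|m IHm].
have Dc : D m.+1 = ((D m.+1).[0])%:P.
  by apply: deriv_eq0_const; rewrite D' IHm scaler0.
set c := _.[0] in Dc.
have /deriv_eq0_const : (D m.+2 - (m.+2%:R * c) *: 'X)^`() = 0.
  by rewrite derivB derivZ derivX D' Dc -[c%:P]alg_polyC scalerA subrr.
move=> /(congr1 (fun P : {poly rat} => P.[1])); rewrite !hornerE D01 => /eqP.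
rewrite -subr_eq0 addrAC subrr add0r.
rewrite oppr_eq0 mulf_eq0 pnatr_eq0 /= => /eqP c0.
by rewrite Dc c0.
Qed.

(** * The p-adic norm *)

Section PadicNorm.
Variables (R : realType) (p : nat) (K : padic_closure R p).
Hypothesis p_prime : prime p.
Implicit Types (x y : K) (n m t : nat).
Local Notation nu := (@pnorm R p K).

Lemma pnorm0 : nu 0 = 0. Proof. exact/pnorm_eq0. Qed.

Lemma pnorm_neq0 x : x != 0 -> nu x != 0.
Proof. by apply: contra_neq => /pnorm_eq0. Qed.

Lemma pnorm1 : nu 1 = 1.
Proof. by apply: (mulfI (pnorm_neq0 (oner_neq0 _))); rewrite -pnormM !mulr1. Qed.

Lemma pnormN x : nu (- x) = nu x.
Proof.
rewrite -mulN1r pnormM; suff -> : nu (-1) = 1 by rewrite mul1r.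
have /eqP : nu (-1) ^+ 2 = 1 by rewrite expr2 -pnormM mulrNN mulr1 pnorm1.
rewrite sqrf_eq1 => /orP[/eqP //|/eqP N1].
by have := pnorm_ge0 (-1 : K); rewrite N1 ler0N1.
Qed.

Lemma pnorm_distC x y : nu (x - y) = nu (y - x).
Proof. by rewrite -pnormN opprB. Qed.

Lemma pnormX x n : nu (x ^+ n) = nu x ^+ n.
Proof. by elim: n => [|n IHn]; rewrite ?pnorm1 // !exprS pnormM IHn. Qed.

Lemma pnormV x : nu x^-1 = (nu x)^-1.
Proof.
have [->|x0] := eqVneq x 0; first by rewrite invr0 pnorm0 invr0.
by apply: (mulfI (pnorm_neq0 x0)); rewrite -pnormM !divff ?pnorm1 ?pnorm_neq0.
Qed.

Lemma pnormD_le x y (e : R) : nu x <= e -> nu y <= e -> nu (x + y) <= e.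
Proof. by move=> xe ye; rewrite (le_trans (pnormD _ _)) // ge_max xe. Qed.

Lemma pnormD_lt x y (e : R) : nu x < e -> nu y < e -> nu (x + y) < e.
Proof. by move=> xe ye; rewrite (le_lt_trans (pnormD _ _)) // gt_max xe. Qed.

Lemma pnormB_le x y (e : R) : nu x <= e -> nu y <= e -> nu (x - y) <= e.
Proof. by move=> xe ye; apply: pnormD_le; rewrite ?pnormN. Qed.

Lemma pnormB_lt x y (e : R) : nu x < e -> nu y < e -> nu (x - y) < e.
Proof. by move=> xe ye; apply: pnormD_lt; rewrite ?pnormN. Qed.

Lemma pnorm_sum_le I (s : seq I) (P : pred I) (F : I -> K) (e : R) : 0 <= e ->
  (forall i, P i -> nu (F i) <= e) -> nu (\sum_(i <- s | P i) F i) <= e.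
Proof.
by move=> e0 H; elim/big_ind: _ => [|x y|//]; rewrite ?pnorm0 //; apply: pnormD_le.
Qed.

Lemma pnorm_nat_le1 n : nu n%:R <= 1.
Proof.
elim: n => [|n IHn]; first by rewrite pnorm0 ler01.
by rewrite -natr1 pnormD_le // pnorm1.
Qed.

Let p_gt0 : (0 < p)%N := prime_gt0 p_prime.

Lemma pR_gt1 : 1 < p%:R :> R.
Proof. by rewrite ltr1n prime_gt1. Qed.

Lemma pR_gt0 : 0 < p%:R :> R.
Proof. by rewrite ltr0n. Qed.

Lemma pRV_lt1 : p%:R^-1 < 1 :> R.
Proof. by rewrite invf_lt1 ?pR_gt0 ?pR_gt1. Qed.

Lemma pRV_ge0 : 0 <= p%:R^-1 :> R.
Proof. by rewrite invr_ge0 ler0n. Qed.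

Lemma pRVX_gt0 t : 0 < p%:R^-1 ^+ t :> R.
Proof. by rewrite exprn_gt0 // invr_gt0 pR_gt0. Qed.

Lemma pnorm_dvd t n : (p ^ t %| n)%N -> nu n%:R <= p%:R^-1 ^+ t.
Proof.
move=> /dvdnP[m ->]; rewrite natrM pnormM natrX pnormX pnorm_p.
by rewrite ler_piMl ?pnorm_nat_le1 // ltW ?pRVX_gt0.
Qed.

(** Bezout writes 1 as a combination of p and n; were both of norm below 1, so would be 1. *)
Lemma pnorm_coprime n : ~~ (p %| n)%N -> nu n%:R = 1.
Proof.
move=> pn; apply/eqP; rewrite eq_le pnorm_nat_le1 /= leNgt; apply/negP => n_lt1.
have [u v E _] := egcdnP n p_gt0.
have := congr1 (fun i : nat => i%:R : K) E.
have /eqP -> : coprime p n by rewrite prime_coprime.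
rewrite natrD !natrM => /eqP; rewrite addrC -subr_eq => /eqP E1.
have : nu 1%:R < 1.
  rewrite -E1; apply: pnormB_lt; rewrite pnormM; last first.
    by rewrite (le_lt_trans _ n_lt1) // ler_piMl ?pnorm_ge0 ?pnorm_nat_le1.
  rewrite pnorm_p (le_lt_trans _ pRV_lt1) //.
  by rewrite ler_piMl ?pRV_ge0 ?pnorm_nat_le1.
by rewrite mulr1n pnorm1 ltxx.
Qed.

Lemma pnorm_logn n : (0 < n)%N -> nu n%:R = p%:R^-1 ^+ logn p n.
Proof.
move=> n_gt0; have [m pm E] := pfactor_coprime p_prime n_gt0.
rewrite {1}E natrM pnormM pnorm_coprime -?prime_coprime // mul1r natrX pnormX.
by rewrite pnorm_p.
Qed.

Lemma natK_neq0 n : (0 < n)%N -> n%:R != 0 :> K.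
Proof.
move=> n_gt0; apply/eqP => /pnorm_eq0 /eqP.
by rewrite pnorm_logn // gt_eqF ?pRVX_gt0.
Qed.

(** A crude bound, since [p ^ logn p n] divides n; it controls the denominators in the Bernoulli,
    binomial and logarithm estimates. *)
Lemma pnorm_natV n : (0 < n)%N -> nu n%:R^-1 <= n%:R.
Proof.
move=> n_gt0; rewrite pnormV pnorm_logn // exprVn invrK -natrX ler_nat.
by rewrite dvdn_leq // pfactor_dvdnn.
Qed.

Lemma pRVX_lt (e : R) : 0 < e -> exists m, forall n, (m <= n)%N ->
  p%:R^-1 ^+ n < e.
Proof.
move=> e_gt0; have : 0 <= e^-1 by rewrite invr_ge0 ltW.
move=> /archi_boundP; set m := Num.bound _ => em.
exists m => n mn; rewrite exprVn invf_plt ?posrE ?exprn_gt0 ?pR_gt0 //.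
rewrite (lt_trans em) // -natrX ltr_nat (leq_ltn_trans mn) //.
by rewrite ltn_expl ?prime_gt1.
Qed.

End PadicNorm.

(* Equal to [ratr]; the primality proof is what makes it a ring morphism, since
   the library only provides one into a [numFieldType]. *)
Definition ratp (R : realType) (p : nat) (K : padic_closure R p)
  (p_prime : prime p) : rat -> K := ratr.

Section RatMorphism.
Variables (R : realType) (p : nat) (K : padic_closure R p).
Variable p_prime : prime p.

Fact intK_neq0 (z : int) : z != 0 -> z%:~R != 0 :> K.
Proof.
case: z => n; first by move=> n0; rewrite -pmulrn natK_neq0 // lt0n.
by move=> _; rewrite NegzE mulrNz oppr_eq0 -pmulrn; apply: natK_neq0.
Qed.

Lemma ratp_frac (a b : int) : b != 0 ->
  ratp K p_prime (a%:~R / b%:~R) = a%:~R / b%:~R.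
Proof.
move=> b0; set x : rat := a%:~R / b%:~R.
have E : numq x * b = a * denq x.
  apply: (@intr_inj rat); rewrite !rmorphM /= numqE /x mulrAC divfK //.
  by rewrite intr_eq0.
apply: (canLR (mulfK (intK_neq0 (denq_neq0 x)))).
rewrite mulrAC; apply: (canRL (mulfK (intK_neq0 b0))); rewrite -!rmorphM; congr _%:~R.
by rewrite E.
Qed.

Lemma ratp_num_den x : ratp K p_prime x = (numq x)%:~R / (denq x)%:~R.
Proof. by []. Qed.

Fact ratp_is_zmod_morphism : zmod_morphism (ratp K p_prime).
Proof.
move=> x y.
have ex := denq_neq0 x; have ey := denq_neq0 y.
have -> : x - y = (numq x * denq y - numq y * denq x)%:~R /
                  (denq x * denq y)%:~R.
  rewrite -{1}[x]divq_num_den -{1}[y]divq_num_den rmorphB !rmorphM /=.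
  by field; rewrite !intr_eq0 ex ey.
rewrite ratp_frac ?mulf_neq0 // !ratp_num_den rmorphB !rmorphM /=.
by field; rewrite !intK_neq0.
Qed.

Fact ratp_is_monoid_morphism : monoid_morphism (ratp K p_prime).
Proof.
split=> [|x y]; first by rewrite /ratp /ratr divr1.
have ex := denq_neq0 x; have ey := denq_neq0 y.
have -> : x * y = (numq x * numq y)%:~R / (denq x * denq y)%:~R.
  rewrite -{1}[x]divq_num_den -{1}[y]divq_num_den !rmorphM /=.
  by field; rewrite !intr_eq0 ex ey.
rewrite ratp_frac ?mulf_neq0 // !ratp_num_den !rmorphM /=.
by field; rewrite !intK_neq0.
Qed.

HB.instance Definition _ := GRing.isZmodMorphism.Build rat K (ratp K p_prime)
  ratp_is_zmod_morphism.
HB.instance Definition _ := GRing.isMonoidMorphism.Build rat K (ratp K p_prime)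
  ratp_is_monoid_morphism.

End RatMorphism.

(** * Limits *)

(** One delta for the three terms of [u v - l m = (u - l)(v - m) + (u - l) m + l (v - m)], shared by
    the continuity of products and of polynomials. *)
Lemma min_mulr_lt (R : realFieldType) (e a b s t : R) :
  0 < e -> 0 <= a -> 0 <= b -> 0 <= s -> 0 <= t ->
  s < Num.min 1 (e / (1 + a + b + e)) -> t < Num.min 1 (e / (1 + a + b + e)) ->
  [/\ s * t < e, s * b < e & a * t < e].
Proof.
move=> e0 a0 b0 s0 t0; set d := Num.min _ _ => sd td.
have c0 : 0 < 1 + a + b + e by rewrite ltr_wpDl // ?addr_ge0.
have d0 : 0 < d by rewrite lt_min ltr01 divr_gt0.
have d1 : d <= 1 by rewrite ge_min lexx.
have de : d * (1 + a + b + e) <= e.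
  by rewrite -ler_pdivlMr // ge_min lexx orbT.
have da : 0 <= d * a by rewrite mulr_ge0 // ltW.
have db : 0 <= d * b by rewrite mulr_ge0 // ltW.
have de0 : 0 < d * e by rewrite mulr_gt0.
have sb : s * b <= d * b by rewrite ler_wpM2r // ltW.
have ta : a * t <= d * a by rewrite mulrC ler_wpM2r // ltW.
have st : s * t <= d * t by rewrite ler_wpM2r // ltW.
have dt : d * t <= t by rewrite ler_piMl.
by split; lra.
Qed.

Section Limits.
Variables (R : realType) (p : nat) (K : padic_closure R p).
Hypothesis p_prime : prime p.
Implicit Types (x y l m : K) (u v : nat -> K).
Local Notation nu := (@pnorm R p K).
Local Notation "u ~> l" := (tends_to nu u l) (at level 70).

Lemma tends_to_cst x : (fun=> x) ~> x.
Proof. by move=> e e0; exists 0%N => n _; rewrite subrr pnorm0. Qed.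

Lemma tends_to_eq u v l : u =1 v -> u ~> l -> v ~> l.
Proof. by move=> uv ul e /ul[m H]; exists m => n /H; rewrite uv. Qed.

Lemma tends_toD u v l m : u ~> l -> v ~> m -> (fun n => u n + v n) ~> l + m.
Proof.
move=> ul vm e e0; have [a Ha] := ul e e0; have [b Hb] := vm e e0.
exists (maxn a b) => n; rewrite geq_max => /andP[/Ha ua /Hb ub].
by rewrite opprD addrACA pnormD_lt.
Qed.

Lemma tends_toN u l : u ~> l -> (fun n => - u n) ~> - l.
Proof. by move=> ul e /ul[a Ha]; exists a => n /Ha; rewrite -opprD pnormN. Qed.

Lemma tends_toB u v l m : u ~> l -> v ~> m -> (fun n => u n - v n) ~> l - m.
Proof. by move=> ul vm; apply: tends_toD => //; apply: tends_toN. Qed.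

Lemma tends_toM u v l m : u ~> l -> v ~> m -> (fun n => u n * v n) ~> l * m.
Proof.
move=> ul vm e e0.
pose d := Num.min 1 (e / (1 + nu l + nu m + e)).
have d0 : 0 < d.
  by rewrite lt_min ltr01 divr_gt0 // ltr_wpDl // ?addr_ge0 ?pnorm_ge0.
have [a Ha] := ul d d0; have [b Hb] := vm d d0.
exists (maxn a b) => n; rewrite geq_max => /andP[/Ha ua /Hb ub].
have -> : u n * v n - l * m =
  (u n - l) * (v n - m) + ((u n - l) * m + l * (v n - m)) by ring.
have [||||H1 H2 H3] := min_mulr_lt e0 _ _ _ _ ua ub; rewrite ?pnorm_ge0 //.
by rewrite !pnormD_lt // pnormM.
Qed.

Lemma tends_toZ x u l : u ~> l -> (fun n => x * u n) ~> x * l.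
Proof. exact/tends_toM/tends_to_cst. Qed.

Lemma tends_to_sum I (s : seq I) (P : pred I) (F : I -> nat -> K) (f : I -> K) :
  (forall i, P i -> F i ~> f i) ->
  (fun n => \sum_(i <- s | P i) F i n) ~> \sum_(i <- s | P i) f i.
Proof.
move=> H; elim: s => [|i s IHs].
  by under eq_fun do rewrite big_nil; rewrite big_nil; apply: tends_to_cst.
under eq_fun do rewrite big_cons; rewrite big_cons.
by case: ifP => // Pi; apply: tends_toD => //; apply: H.
Qed.

Lemma tends_to_prod I (s : seq I) (P : pred I) (F : I -> nat -> K) (f : I -> K) :
  (forall i, P i -> F i ~> f i) ->
  (fun n => \prod_(i <- s | P i) F i n) ~> \prod_(i <- s | P i) f i.
Proof.
move=> H; elim: s => [|i s IHs].
  by under eq_fun do rewrite big_nil; rewrite big_nil; apply: tends_to_cst.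
under eq_fun do rewrite big_cons; rewrite big_cons.
by case: ifP => // Pi; apply: tends_toM => //; apply: H.
Qed.

Lemma tends_to_unique u l m : u ~> l -> u ~> m -> l = m.
Proof.
move=> ul um; apply/eqP; rewrite -subr_eq0; apply/eqP/(@pnorm_eq0 R p K).
apply/eqP; apply: contraT => lm.
have e0 : 0 < nu (l - m) by rewrite lt_neqAle eq_sym lm pnorm_ge0.
have [a Ha] := ul _ e0; have [b Hb] := um _ e0.
have := Ha (maxn a b) (leq_maxl _ _); have := Hb (maxn a b) (leq_maxr _ _).
move=> H1 H2; have := pnormB_lt H1 H2.
by rewrite opprB addrC addrA subrK ltxx.
Qed.

Lemma tends_to_geometric (C : R) u l : 0 < C ->
  (forall n, nu (u n - l) <= C * p%:R^-1 ^+ n) -> u ~> l.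
Proof.
move=> C0 H e e0; have [m Hm] := pRVX_lt p_prime (divr_gt0 e0 C0).
exists m => n mn; apply: le_lt_trans (H n) _.
by rewrite mulrC -ltr_pdivlMr // Hm.
Qed.

Lemma plimE u l : u ~> l -> plim u = l.
Proof.
by move=> ul; apply: xget_unique => // m um; apply: tends_to_unique um ul.
Qed.

Lemma poly_continuous (P : {poly K}) x (e : R) : 0 < e ->
  exists2 d : R, 0 < d & forall y, nu (y - x) < d -> nu (P.[y] - P.[x]) < e.
Proof.
elim/poly_ind: P e => [|P c IHP] e e0.
  by exists 1 => // y _; rewrite !horner0 subrr pnorm0.
pose d := Num.min 1 (e / (1 + nu P.[x] + nu x + e)).
have d0 : 0 < d.
  by rewrite lt_min ltr01 divr_gt0 // ltr_wpDl // ?addr_ge0 ?pnorm_ge0.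
have [d' d'0 H] := IHP d d0; exists (Num.min d d'); first by rewrite lt_min d0.
move=> y; rewrite lt_min => /andP[yd /H Py]; rewrite !hornerE.
have -> : P.[y] * y + c - (P.[x] * x + c) = (P.[y] - P.[x]) * (y - x) +
  ((P.[y] - P.[x]) * x + P.[x] * (y - x)) by ring.
have [||||H1 H2 H3] := min_mulr_lt e0 _ _ _ _ Py yd; rewrite ?pnorm_ge0 //.
by rewrite !pnormD_lt // pnormM.
Qed.

End Limits.

(** * Primitive Dirichlet characters *)

(** Take t to be the product of the primes of M that do not divide b. A prime of M dividing b
    divides neither d nor t; any other one divides t but not b. This replaces a class modulo d by a
    representative prime to a larger modulus. *)
Lemma coprime_shift (b d M : nat) : coprime b d -> (0 < M)%N ->
  exists t, coprime (b + d * t) M.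
Proof.
move=> bd M0; pose t := (\prod_(l <- primes M | ~~ (l %| b)) l)%N; exists t.
apply: contraT => ncop; have g1 : (1 < gcdn (b + d * t) M)%N.
  by rewrite ltn_neqAle eq_sym ncop gcdn_gt0 M0 orbT.
have [l_pr lb lM] : [/\ prime (pdiv (gcdn (b + d * t) M)),
    pdiv (gcdn (b + d * t) M) %| b + d * t & pdiv (gcdn (b + d * t) M) %| M]%N.
  by rewrite pdiv_prime // !(dvdn_trans (pdiv_dvd _)) ?dvdn_gcdl ?dvdn_gcdr.
set l := pdiv _ in l_pr lb lM.
have lM' : l \in primes M by rewrite mem_primes l_pr M0.
have [l_b|l_b] := boolP (l %| b)%N; last first.
  move: lb; rewrite dvdn_addl ?(negPf l_b) // dvdn_mull // /t.
  by rewrite (big_rem l) //= l_b dvdn_mulr.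
move: lb; rewrite dvdn_addr // Euclid_dvdM // => /orP[l_d|].
  have : (l %| gcdn b d)%N by rewrite dvdn_gcd l_b.
  by rewrite (eqP bd) dvdn1 => /eqP l1; rewrite l1 in l_pr.
apply: contraTT => _; rewrite /t big_seq_cond.
elim/big_ind: _ => [|x y lx ly|q /andP[]]; first by rewrite dvdn1 gtn_eqF ?prime_gt1.
  by rewrite Euclid_dvdM // negb_or lx.
rewrite mem_primes => /andP[q_pr _] qb.
by apply: contraNN qb; rewrite dvdn_prime2 // => /eqP <-.
Qed.

Lemma modn_invertible (a f : nat) : coprime a f -> (0 < f)%N ->
  exists2 c, coprime c f & (a * c = 1 %[mod f])%N.
Proof.
move=> af f0; exists (a ^ (totient f).-1)%N; first by rewrite coprimeXl.
by rewrite -expnS prednK ?totient_gt0 // Euler_exp_totient.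
Qed.

Lemma coprime_modP (a b d : nat) : (a = b %[mod d])%N ->
  coprime a d = coprime b d.
Proof. by move=> ab; rewrite -coprime_modl ab coprime_modl. Qed.

Section Dirichlet.
Variables (R : realType) (p : nat) (K : padic_closure R p).
Implicit Types (chi psi theta : nat -> K) (a b d f M N : nat).

Section Character.
Variables (f : nat) (chi : nat -> K).
Hypothesis dchi : dirichlet_character f chi.

Lemma dchar_gt0 : (0 < f)%N. Proof. by case: dchi. Qed.

Lemma dchar1 : chi 1%N = 1. Proof. by case: dchi. Qed.

Lemma dcharM a b : chi (a * b)%N = chi a * chi b.
Proof. by case: dchi. Qed.

Lemma dchar_neq0 a : (chi a != 0) = coprime a f. Proof. by case: dchi. Qed.

Lemma dcharX a n : chi (a ^ n)%N = chi a ^+ n.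
Proof. by elim: n => [|n IHn]; rewrite ?dchar1 // expnS exprS dcharM IHn. Qed.

Lemma dchar_periodM a t : chi (a + f * t)%N = chi a.
Proof.
elim: t => [|t IHt]; first by rewrite muln0 addn0.
by rewrite mulnS addnCA addnC; case: dchi => _ _ _ -> _.
Qed.

Lemma dchar_mod a : chi (a %% f)%N = chi a.
Proof. by rewrite {2}(divn_eq a f) addnC mulnC dchar_periodM. Qed.

Lemma dchar_eq_mod a b : (a = b %[mod f])%N -> chi a = chi b.
Proof. by move=> ab; rewrite -dchar_mod ab dchar_mod. Qed.

Lemma dchar_root1 a : coprime a f -> chi a ^+ totient f = 1.
Proof.
move=> af; rewrite -dcharX -dchar1; apply: dchar_eq_mod.
exact: Euler_exp_totient.
Qed.

End Character.

(** The conductor d is the least divisor of f such that chi is trivial on the units modulo f that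
    are 1 modulo d. Then chi(a) depends only on a modulo d, so theta is defined by lifting a to a
    representative prime to f; minimality of d gives primitivity. *)
Lemma dchar_inducing_primitive f chi : dirichlet_character f chi ->
  exists2 d, (d %| f)%N &
    exists2 theta, primitive_mod d theta & forall a, coprime a f -> theta a = chi a.
Proof.
move=> dchi; have f0 := dchar_gt0 dchi.
pose P d := `[< [/\ (0 < d)%N, (d %| f)%N &
  forall a, coprime a f -> (a = 1 %[mod d])%N -> chi a = 1] >].
have exP : exists d, P d.
  exists f; apply/asboolP; split=> // a _ a1.
  by rewrite (dchar_eq_mod dchi a1) (dchar1 dchi).
have [d /asboolP[d0 df chi1] d_min] := ex_minnP exP.
have chi_eq a b : coprime a f -> coprime b f -> (a = b %[mod d])%N -> chi a = chi b.
  move=> af bf ab; have [c cf bc] := modn_invertible bf f0.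
  have chic : chi c != 0 by rewrite (dchar_neq0 dchi).
  apply: (mulIf chic); rewrite -!(dcharM dchi) (dchar_eq_mod dchi bc).
  rewrite (dchar1 dchi) chi1 // ?coprimeMl ?af //.
  by rewrite -modnMml ab modnMml -(modn_dvdm _ df) bc modn_dvdm.
have lift_ex a : exists t, coprime a d -> coprime (a + d * t) f.
  have [ad|nad] := boolP (coprime a d); last by exists 0%N.
  by have [t] := coprime_shift ad f0; exists t.
have [lift liftP] := choice lift_ex.
pose theta a := if coprime a d then chi (a + d * lift a)%N else 0.
have thetaE a b : coprime b f -> (a = b %[mod d])%N -> theta a = chi b.
  move=> bf ab; have ad : coprime a d.
    by rewrite (coprime_modP ab) (coprime_dvdr df).
  rewrite /theta ad; apply: chi_eq (liftP a ad) bf _.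
  by rewrite addnC mulnC modnMDl.
have theta_f a : coprime a f -> theta a = chi a by move=> af; apply: thetaE.
have theta0 a : (theta a != 0) = coprime a d.
  rewrite /theta; case: ifP => [ad|]; last by rewrite eqxx.
  by rewrite (dchar_neq0 dchi); apply: liftP.
have dtheta : dirichlet_character d theta.
  split=> //; first by rewrite theta_f ?coprime1n // (dchar1 dchi).
    move=> a b; have [|nab] := boolP (coprime (a * b) d); last first.
      move: (nab); rewrite -theta0 negbK => /eqP ->; move: nab.
      by rewrite coprimeMl negb_and -!theta0 !negbK -mulf_eq0 => /eqP ->.
    rewrite coprimeMl => /andP[ad bd].
    rewrite (thetaE a _ (liftP a ad)); last by rewrite addnC mulnC modnMDl.
    rewrite (thetaE b _ (liftP b bd)); last by rewrite addnC mulnC modnMDl.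
    rewrite -(dcharM dchi); apply: thetaE; first by rewrite coprimeMl !liftP.
    by apply/esym; rewrite -modnMml -modnMmr ![(_ + d * _)%N]addnC ![(d *
      _)%N]mulnC !modnMDl modnMml modnMmr.
  move=> a; have [ad|nad] := boolP (coprime a d).
    rewrite (thetaE (a + d)%N _ (liftP a ad)); last first.
      by rewrite modnDr addnC mulnC modnMDl.
    by rewrite (thetaE a _ (liftP a ad)) // addnC mulnC modnMDl.
  apply/eqP; move: (nad); rewrite -theta0 negbK => /eqP ->.
  by rewrite -[_ == _]negbK theta0 /coprime gcdnC gcdnDr gcdnC.
exists d => //; exists theta => //; split=> // e ed theta1.
apply/eqP; rewrite eqn_leq dvdn_leq //=; apply: d_min; apply/asboolP.
split; [exact: dvdn_gt0 ed|exact: dvdn_trans df|].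
by move=> a af a1; rewrite -theta_f // theta1 // (coprime_dvdr df).
Qed.

(* By Bezout, any a = 1 modulo gcd f f' is congruent modulo f to some b = 1
   modulo f', so that chi a = chi b = chi' b = 1 once b is made prime to M. *)
Lemma primitive_modulus_dvd f f' M chi chi' : (0 < M)%N ->
  primitive_mod f chi -> primitive_mod f' chi' ->
  (forall a, coprime a M -> chi a = chi' a) -> (f %| f')%N.
Proof.
move=> M0 [dchi prim] [dchi' _] E.
have f0 := dchar_gt0 dchi; have f'0 := dchar_gt0 dchi'.
suff -> : f = gcdn f f' by rewrite dvdn_gcdr.
apply/esym/prim; first exact: dvdn_gcdl.
move=> a af a1; rewrite -(dchar_periodM dchi a 1) muln1.
have : (a + f = 1 %[mod gcdn f f'])%N.
  by rewrite -modnDmr (eqP (dvdn_gcdl f f')) addn0.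
have : (0 < a + f)%N by rewrite addn_gt0 f0 orbT.
have : coprime (a + f) f by rewrite /coprime gcdnC gcdnDr gcdnC.
move: {a af a1}(a + f)%N => a af a0 /eqP; rewrite eqn_mod_dvd // => /dvdnP[m Em].
have [u v uv _] := egcdnP f f'0.
have Eb : (a + v * f * m = 1 + u * f' * m)%N.
  by rewrite uv gcdnC -(subnKC a0) Em; lia.
have bff' : coprime (a + v * f * m) (f * f').
  rewrite coprimeMr; apply/andP; split.
    by rewrite (@coprime_modP _ a) // mulnAC addnC modnMDl.
  by rewrite Eb (@coprime_modP _ 1) ?coprime1n // mulnAC addnC modnMDl.
have [t /E] := coprime_shift bff' M0.
rewrite (dchar_eq_mod dchi' (_ : _ = 1 %[mod f'])%N); last first.
  rewrite Eb (_ : _ + _ = (u * m + f * t) * f' + 1)%N ?modnMDl //; lia.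
rewrite (dchar1 dchi') => <-; apply/esym/(dchar_eq_mod dchi).
rewrite (_ : a + _ + _ = (v * m + f' * t) * f + a)%N ?modnMDl //; lia.
Qed.

(** Makes [conductor] well defined, and reduces equality of primitive characters to the integers
    prime to any convenient M, for instance those where a twist is given by its formula. *)
Lemma primitive_mod_unique f f' M chi chi' : (0 < M)%N ->
  primitive_mod f chi -> primitive_mod f' chi' ->
  (forall a, coprime a M -> chi a = chi' a) -> f = f' /\ chi = chi'.
Proof.
move=> M0 pchi pchi' E.
have ff' : f = f'.
  apply/eqP; rewrite eqn_dvd (primitive_modulus_dvd M0 pchi pchi') //.
  by apply: (primitive_modulus_dvd M0 pchi' pchi) => a /E.
split=> //; subst f'; have [dchi _] := pchi; have [dchi' _] := pchi'.
apply/funext => a; have [af|naf] := boolP (coprime a f); last first.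
  apply/eqP; move: (naf); rewrite -(dchar_neq0 dchi) negbK => /eqP ->.
  by move: naf; rewrite -(dchar_neq0 dchi') negbK eq_sym.
have [t /E] := coprime_shift af M0.
by rewrite (dchar_periodM dchi) (dchar_periodM dchi').
Qed.

Lemma conductorE f chi : primitive_mod f chi -> conductor chi = f.
Proof.
move=> pchi; apply: xget_unique => // f' pchi'.
by have [] := primitive_mod_unique (ltn0Sn 0) pchi' pchi (fun=> fun=> erefl).
Qed.

Lemma primitive_conductor chi :
  primitive_character chi -> primitive_mod (conductor chi) chi.
Proof. by move=> [f pf]; rewrite (conductorE pf). Qed.

Lemma conductor_dchar chi :
  primitive_character chi -> dirichlet_character (conductor chi) chi.
Proof. by move=> /primitive_conductor[]. Qed.

Lemma conductor_gt0 chi : primitive_character chi -> (0 < conductor chi)%N.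
Proof. by move=> /conductor_dchar/dchar_gt0. Qed.

Lemma primitive_character_ext M chi chi' : (0 < M)%N ->
  primitive_character chi -> primitive_character chi' ->
  (forall a, coprime a M -> chi a = chi' a) -> chi = chi'.
Proof.
by move=> M0 [f pf] [f' pf'] /(primitive_mod_unique M0 pf pf')[].
Qed.

Lemma primitive_trivial : primitive_mod 1 (@trivial_character R p K).
Proof.
split; last by move=> d; rewrite dvdn1 => /eqP.
by split=> // [a b|a]; rewrite /trivial_character ?mulr1 // coprimen1 oner_neq0.
Qed.

Lemma conductor1_trivial chi : primitive_character chi -> conductor chi = 1%N ->
  chi = @trivial_character R p K.
Proof.
move=> /conductor_dchar dchi f1; rewrite f1 in dchi; apply/funext => a.
by rewrite (dchar_eq_mod dchi (_ : _ = 1 %[mod 1])%N) ?modn1 // (dchar1 dchi).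
Qed.

End Dirichlet.

(** * Orthogonality *)

Lemma closed_unity_roots (F : closedFieldType) (e : nat) : e%:R != 0 :> F ->
  exists rs : seq F, [/\ uniq rs, size rs = e, rs =i e.-unity_root
    & 'X^e - 1 = \prod_(z <- rs) ('X - z%:P)].
Proof.
move=> e0; have e_gt0 : (0 < e)%N by case: e e0; rewrite ?eqxx.
have [rs E] := closed_field_poly_normal ('X^e - 1 : {poly F}).
have lc : lead_coef ('X^e - 1 : {poly F}) = 1.
  by apply/eqP; rewrite -monicE -polyC1 monicXnsubC.
rewrite lc scale1r in E.
have := separable_Xn_sub_1 e0; rewrite E separable_prod_XsubC => urs.
exists rs; split=> // [|z].
  by apply/succn_inj; rewrite -(size_prod_XsubC _ id) -E size_XnsubC.
rewrite [RHS](unity_rootE e z) -root_prod_XsubC -E rootE !hornerE. 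
by rewrite subr_eq0.
Qed.

Lemma closed_prim_root (F : closedFieldType) (e : nat) : e%:R != 0 :> F ->
  exists z : F, e.-primitive_root z.
Proof.
move=> e0; have e_gt0 : (0 < e)%N by case: e e0; rewrite ?eqxx.
have [rs [urs srs rsE _]] := closed_unity_roots e0.
have : has e.-primitive_root rs.
  by apply: has_prim_root; rewrite ?srs //; apply/allP => z; rewrite rsE.
by move=> /hasP[z _ z_prim]; exists z.
Qed.

Section Orthogonality.
Variables (R : realType) (p : nat) (K : padic_closure R p).
Hypothesis p_prime : prime p.
Implicit Types (chi psi theta : nat -> K) (a b d f M N : nat).

(* Sends the values of a suitable irreducible character over algC to K through
   a bijection between the roots of unity of order #|(Z/N)^*|. *)
Lemma dchar_separates N x : (0 < N)%N -> coprime x N -> x != 1 %[mod N] ->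
  exists2 chi : nat -> K, dirichlet_character N chi & chi x != 1.
Proof.
case: N => [//|[|N']] _; first by rewrite !modn1.
set N := N'.+2 => xN x1.
pose toU (a : nat) : {unit 'Z_N} := insubd (1%g : {unit 'Z_N}) (a%:R : 'Z_N).
have toUE a : coprime a N -> val (toU a) = a%:R.
  by move=> aN; rewrite val_insubd unitZpE // coprime_sym aN.
have toUM a b : coprime a N -> coprime b N -> toU (a * b)%N = (toU a * toU b)%g.
  move=> aN bN; apply: val_inj; rewrite /= !toUE ?coprimeMl ?aN //.
  by rewrite natrM.
have toU_mod a b : (a = b %[mod N])%N -> toU a = toU b.
  move=> ab; rewrite /toU; congr insubd; apply/eqP.
  by rewrite -(Zp_nat_mod _ a) // ab Zp_nat_mod.
pose G := [set: {unit 'Z_N}]%G.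
have Gab : abelian G := units_Zp_abelian N.
have Ux : toU x != 1%g.
  apply: contra x1 => /eqP/(congr1 val); rewrite /= toUE // => x1.
  by have /eqP := congr1 val x1; rewrite /= !val_Zp_nat.
(* The kernels of the irreducible characters of a finite group intersect trivially; as the group is
   abelian, these characters are linear. *)
have [i chi_x] : exists i : Iirr G, 'chi_i (toU x) != 1.
  apply/existsP; apply: contraR Ux => /existsPn H.
  apply/eqP/set1gP; rewrite -(TI_cfker_irr G); apply/finset.bigcapP => i _.
  rewrite cfkerEirr inE lin_char1 ?(char_abelianP _ _) //.
  by have := H i; rewrite negbK.
have lin := char_abelianP _ Gab i.
pose e := #|G|; have e0 : (0 < e)%N by apply: cardG_gt0.
have [z z_prim] := C_prim_root_exists e0.
have [w w_prim] := closed_prim_root (natK_neq0 K p_prime e0).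
have ex_j (g : {unit 'Z_N}) : exists j : nat, 'chi_i g = z ^+ j.
  have : 'chi_i g ^+ e = 1.
    by rewrite -lin_charX ?inE // expg_cardG ?inE // lin_char1.
  by move=> /(prim_rootP z_prim)[j]; exists j.
have [j jE] := choice ex_j.
have jM a b : coprime a N -> coprime b N ->
    w ^+ j (toU (a * b)%N) = w ^+ j (toU a) * w ^+ j (toU b).
  move=> aN bN; rewrite -exprD; apply/eqP.
  rewrite (eq_prim_root_expr w_prim) -(eq_prim_root_expr z_prim) exprD -!jE.
  by rewrite toUM // lin_charM ?inE.
exists (fun a => if coprime a N then w ^+ j (toU a) else 0); last first.
  by move: chi_x; rewrite xN jE -(prim_order_dvd z_prim) (prim_order_dvd w_prim).
have w0 : w != 0.
  apply: contra_eq_neq (prim_expr_order w_prim) => ->.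
  by rewrite expr0n gtn_eqF // eq_sym oner_neq0.
have wj n : w ^+ n != 0 by rewrite expf_neq0.
split=> // [|a b|a|a].
- have := jM 1%N 1%N (coprime1n N) (coprime1n N); rewrite muln1 coprime1n.
  by move/eqP; rewrite -{1}[w ^+ _]mulr1 eq_sym (inj_eq (mulfI (wj _))) => /eqP.
- rewrite coprimeMl; case: ifP => [/andP[aN bN]|].
    by rewrite aN bN jM.
  by do 2?case: ifP; rewrite ?mulr0 ?mul0r.
- by rewrite (@coprime_modP (a + N) a) ?modnDr // (@toU_mod (a + N)%N a) ?modnDr.
- by case: ifP; rewrite ?wj ?eqxx.
Qed.

Lemma finite_dchar N : (0 < N)%N ->
  finite_set [set chi : nat -> K | dirichlet_character N chi].
Proof.
move=> N0.
have e0 : (0 < totient N)%N by rewrite totient_gt0.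
have [rs [_ _ rsE _]] := closed_unity_roots (natK_neq0 K p_prime e0).
pose vals := 0 :: rs.
pose F (c : {ffun 'I_N -> 'I_(size vals)}) (a : nat) : K :=
  nth 0 vals (c (Ordinal (ltn_pmod a N0))).
apply: (@sub_finite_set _ _ [set F c | c in [set: {ffun 'I_N -> 'I_(size vals)}]]).
  move=> chi dchi; have chi_vals a : chi a \in vals.
    rewrite inE; have [aN|naN] := boolP (coprime a N).
      rewrite rsE orbC; apply/orP; left; rewrite -topredE /=; apply/unity_rootP.
      exact: dchar_root1.
    by move: naN; rewrite -(dchar_neq0 dchi) negbK => ->.
  exists [ffun i : 'I_N => Ordinal (etrans (index_mem _ _) (chi_vals i))] => //.
  by apply/funext => a; rewrite /F ffunE /= nth_index // (dchar_mod dchi).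
exact/finite_image/finite_finset.
Qed.

Lemma dchar_mul N chi psi : dirichlet_character N chi ->
  dirichlet_character N psi -> dirichlet_character N (fun a => chi a * psi a).
Proof.
move=> [N0 chi1 chiM chiD chi0] [_ psi1 psiM psiD psi0].
split=> // [|a b|a|a]; first by rewrite chi1 psi1 mulr1.
- by rewrite chiM psiM mulrACA.
- by rewrite chiD psiD.
- by rewrite mulf_eq0 negb_or chi0 psi0 andbb.
Qed.

Lemma dchar_inv N chi : dirichlet_character N chi ->
  dirichlet_character N (fun a => (chi a)^-1).
Proof.
move=> [N0 chi1 chiM chiD chi0].
split=> // [|a b|a|a]; first by rewrite chi1 invr1.
- by rewrite chiM invfM.
- by rewrite chiD.
- by rewrite invr_eq0 chi0.
Qed.

Definition principal_character N (a : nat) : K := (coprime a N)%:R.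

Lemma dchar_principal N : (0 < N)%N -> dirichlet_character N (principal_character N).
Proof.
rewrite /principal_character => N0; split=> // [|a b|a|a].
- by rewrite coprime1n.
- by rewrite coprimeMl -natrM mulnb.
- by rewrite (@coprime_modP (a + N) a) ?modnDr.
- by case: coprime; rewrite ?oner_neq0 ?eqxx.
Qed.

Lemma sum_dchar_eq0 N chi : dirichlet_character N chi ->
  chi != principal_character N -> \sum_(a < N) chi a = 0.
Proof.
move=> dchi /eqP chi1; have N0 := dchar_gt0 dchi.
have [b bN chib] : exists2 b, coprime b N & chi b != 1.
  apply: contrapT => H; apply: chi1; apply/funext => a; rewrite /principal_character.
  case: (boolP (coprime a N)) => aN.
    by apply/eqP; apply: contraT => chia; case: H; exists a.
  by apply/eqP; rewrite -[_ == _]negbK (dchar_neq0 dchi).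
pose h (a : 'I_N) := Ordinal (ltn_pmod (b * a) N0).
have h_inj : injective h.
  have [c _ bc] := modn_invertible bN N0.
  move=> a a' /(congr1 val)/= E; apply: val_inj; rewrite /=.
  have : (b * c * a = b * c * a' %[mod N])%N.
    by rewrite mulnAC -modnMml E modnMml mulnAC.
  by rewrite -modnMml bc modnMml mul1n -[RHS]modnMml bc modnMml mul1n !modn_small.
have : chi b * (\sum_(a < N) chi a) = \sum_(a < N) chi a.
  rewrite [RHS](reindex_inj h_inj) mulr_sumr; apply: eq_bigr => a _ /=.
  by rewrite (dchar_mod dchi) (dcharM dchi).
move=> /eqP; rewrite -subr_eq0 -{2}[\sum_(_ < _) _]mul1r -mulrBl mulf_eq0.
by rewrite subr_eq0 (negPf chib) => /eqP.
Qed.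

Lemma sum_principal_character N :
  \sum_(a < N) principal_character N a = (totient N)%:R.
Proof.
rewrite totient_count_coprime -natr_sum; congr _%:R.
by rewrite big_mkord; apply: eq_bigr => a _; rewrite coprime_sym.
Qed.

Local Notation chars N := [set chi : nat -> K | dirichlet_character N chi].

Lemma sum_chars_eq0 N x : (0 < N)%N -> coprime x N -> x != 1 %[mod N] ->
  \sum_(chi \in chars N) chi x = 0.
Proof.
move=> N0 xN x1; have [psi dpsi psix] := dchar_separates N0 xN x1.
have H : set_bij (chars N) (chars N) (fun chi a => chi a * psi a).
  split=> [chi /= dchi|chi chi' /set_mem/= dchi /set_mem/= dchi' E|chi dchi].
  - exact: dchar_mul.
  - apply/funext => a; have := congr1 (fun f : nat -> K => f a) E.
    have [aN|naN _] := boolP (coprime a N).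
      by apply: mulIf; rewrite (dchar_neq0 dpsi).
    apply/eqP; move: (naN); rewrite -(dchar_neq0 dchi) negbK => /eqP ->.
    by move: naN; rewrite -(dchar_neq0 dchi') negbK eq_sym.
  - exists (fun a => chi a * (psi a)^-1); first exact/dchar_mul/dchar_inv.
    apply/funext => a; rewrite -mulrA.
    have [aN|naN] := boolP (coprime a N).
      by rewrite mulVf ?mulr1 // (dchar_neq0 dpsi).
    by move: naN; rewrite -(dchar_neq0 dchi) negbK => /eqP ->; rewrite mul0r.
have /eqP : \sum_(chi \in chars N) chi x = \sum_(chi \in chars N) chi x * psi x.
  exact: (reindex_fsbig _ _ _ (fun chi : nat -> K => chi x) H).
rewrite -mulr_fsuml -subr_eq0 -{1}[\sum_(_ \in _) _]mulr1 -mulrBr mulf_eq0.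
by rewrite subr_eq0 [1 == _]eq_sym (negPf psix) orbF => /eqP.
Qed.

(** For x = 1 modulo N the value is the number of characters. It is found by computing the sum of
    all chi(a) in two ways: [sum_chars_eq0] leaves only a = 1, [sum_dchar_eq0] only the principal
    character. *)
Lemma sum_chars N x : (0 < N)%N -> coprime x N ->
  \sum_(chi \in chars N) chi x =
    if x == 1 %[mod N] then (totient N)%:R else 0.
Proof.
move=> N0 xN; case: ifP => [/eqP x1|/negbT]; last exact: sum_chars_eq0.
have finB := finite_dchar N0.
rewrite fsbig_finite //=.
have -> : \sum_(chi <- fset_set (chars N)) chi x =
    \sum_(chi <- fset_set (chars N)) \sum_(a < N) chi a.
  rewrite exchange_big /= (bigD1 (Ordinal (ltn_pmod 1 N0))) //= [X in _ = _ +
    X]big1 ?addr0.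
    apply: eq_big_seq => chi; rewrite in_fset_set // inE /= => dchi.
    by apply: (dchar_eq_mod dchi); rewrite x1 modn_mod.
  move=> a a1; rewrite -fsbig_finite //.
  have [aN|naN] := boolP (coprime a N); last first.
    rewrite fsbig_finite // big_seq big1 // => chi.
    rewrite in_fset_set // inE /= => dchi.
    by apply/eqP; rewrite -[_ == _]negbK (dchar_neq0 dchi).
  apply: sum_chars_eq0 => //; apply: contra a1 => /eqP a1.
  by apply/eqP/val_inj; rewrite /= -a1 modn_small.
rewrite (big_fsetD1 (principal_character N)) /=; last first.
  by rewrite in_fset_set // inE; apply: dchar_principal.
rewrite sum_principal_character big_seq big1 ?addr0 // => chi.
by rewrite !inE in_fset_set // => /andP[chi1]; rewrite inE /= => /sum_dchar_eq0->.
Qed.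

Definition extend_modulus N chi (a : nat) : K := if coprime a N then chi a else 0.

Lemma dchar_extend_modulus f N chi : (0 < N)%N -> (f %| N)%N ->
  dirichlet_character f chi -> dirichlet_character N (extend_modulus N chi).
Proof.
move=> N0 fN dchi; rewrite /extend_modulus; split=> // [|a b|a|a].
- by rewrite coprime1n (dchar1 dchi).
- rewrite coprimeMl (dcharM dchi).
  by do 2?case: coprime; rewrite ?mulr0 ?mul0r.
- rewrite (@coprime_modP (a + N) a) ?modnDr //; case: ifP => // _.
  by case/dvdnP: fN => t ->; rewrite mulnC (dchar_periodM dchi).
- case: (boolP (coprime a N)) => aN; last by rewrite eqxx.
  by rewrite (dchar_neq0 dchi) (coprime_dvdr fN).
Qed.

Local Notation pchars N := [set chi : nat -> K | primitive_character chi /\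
                                           (conductor chi %| N)%N].

(** Carries orthogonality from the characters modulo N to the index set of the theorem. Surjectivity
    is [dchar_inducing_primitive]; injectivity holds because primitive characters that agree on the
    integers prime to N coincide. *)
Lemma pchars_bij N : (0 < N)%N -> set_bij (pchars N) (chars N) (extend_modulus N).
Proof.
move=> N0; split=> [chi /= [/conductor_dchar dchi fN]|chi chi'|chi /= dchi].
- exact: dchar_extend_modulus fN dchi.
- move=> /set_mem/= [pchi _] /set_mem/= [pchi' _] E.
  apply: (primitive_character_ext N0) => // a aN.
  by have := congr1 (fun f : nat -> K => f a) E; rewrite /extend_modulus aN.
- have [d dN [theta ptheta E]] := dchar_inducing_primitive dchi.
  exists theta; first by split; [exists d|rewrite (conductorE ptheta)].
  apply/funext => a; rewrite /extend_modulus; case: ifP => [/E //|/negbT].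
  by rewrite -(dchar_neq0 dchi) negbK => /eqP.
Qed.

Lemma finite_pchars N : (0 < N)%N -> finite_set (pchars N).
Proof.
move=> N0; have [fun_p inj _] := pchars_bij N0.
pose g psi := xget psi [set chi | pchars N chi /\ extend_modulus N chi = psi].
apply: (@sub_finite_set _ _ (g @` chars N)); last exact/finite_image/finite_dchar.
move=> chi pchi; exists (extend_modulus N chi); first exact: fun_p.
apply: xget_unique => // chi' [pchi' E].
by apply: inj => //; apply/mem_set.
Qed.

Lemma sum_pchars N x : (0 < N)%N -> coprime x N ->
  \sum_(chi \in pchars N) chi x =
    if x == 1 %[mod N] then (totient N)%:R else 0.
Proof.
move=> N0 xN; rewrite -sum_chars // (reindex_fsbig _ _ _ _ (pchars_bij N0)).
by apply: eq_fsbigr => chi _; rewrite /extend_modulus xN.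
Qed.

End Orthogonality.

(** * The Teichmuller character *)

Section Teichmuller.
Variables (R : realType) (p : nat) (K : padic_closure R p).
Hypothesis p_prime : prime p.
Implicit Types (chi psi theta : nat -> K) (a b d f n M N : nat).
Local Notation nu := (@pnorm R p K).
Local Notation q := (teichmuller_modulus p).
Local Notation omega := (@teichmuller R p K).

Lemma pnorm_root1 (w : K) n : (0 < n)%N -> w ^+ n = 1 -> nu w = 1.
Proof.
move=> n0 /(congr1 nu); rewrite pnormX pnorm1 => H.
by apply/eqP; rewrite -(pexpr_eq1 n0) ?pnorm_ge0 // H.
Qed.

(** [u^n - 1] is [u - 1] times a sum of n powers of u, all congruent to 1 modulo the maximal ideal;
    that sum is therefore congruent to n, a unit. *)
Lemma pnorm_subX1 (u : K) n : nu (u - 1) < 1 -> nu n%:R = 1 ->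
  nu (u ^+ n - 1) = nu (u - 1).
Proof.
move=> u1 n1; rewrite subrX1 pnormM.
suff -> : nu (\sum_(i < n) u ^+ i) = 1 by rewrite mulr1.
have u_le1 : nu u <= 1.
  by rewrite -[u](subrK 1) pnormD_le ?pnorm1 // ltW.
have ui i : nu (u ^+ i - 1) < 1.
  rewrite subrX1 pnormM (le_lt_trans _ u1) // ler_piMr ?pnorm_ge0 //.
  apply: pnorm_sum_le => // j _; rewrite pnormX exprn_ile1 ?pnorm_ge0 //.
have S : nu (\sum_(i < n) u ^+ i - n%:R) < 1.
  rewrite -[n in n%:R]card_ord -sumr_const -sumrB.
  elim/big_ind: _ => [|x y|i _]; first by rewrite pnorm0.
    exact: pnormD_lt.
  exact: ui.
apply/eqP; rewrite eq_le; apply/andP; split.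
  by rewrite -[X in nu X](subrK n%:R) pnormD_le ?n1 // ltW.
rewrite leNgt; apply/negP => /pnormB_lt/(_ S).
by rewrite opprB addrCA subrr addr0 n1 ltxx.
Qed.

Lemma teichmuller_modulus_gt0 : (0 < q)%N.
Proof. by rewrite /teichmuller_modulus; case: ifP => // _; apply: prime_gt0. Qed.

Lemma coprime_teichmuller_modulus a : coprime a q = ~~ (p %| a)%N.
Proof.
rewrite coprime_sym /teichmuller_modulus; case: ifP => [/eqP ->|_].
  by rewrite (@coprime_pexpl 2 2 a) // prime_coprime.
by rewrite prime_coprime.
Qed.

(** For odd p, w / w' is at distance below 1 from 1; raising to the power p - 1, prime to p,
    preserves this distance ([pnorm_subX1]) but sends w / w' to 1. For p = 2 the roots are 1 and -1,
    and |2| > |4|. *)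
Lemma root_unity_close (w w' : K) : w ^+ totient q = 1 -> w' ^+ totient q = 1 ->
  nu (w - w') <= nu q%:R -> w = w'.
Proof.
have t0 : (0 < totient q)%N by rewrite totient_gt0 teichmuller_modulus_gt0.
rewrite /teichmuller_modulus in t0 *; case: eqP t0 => [p2 _|/eqP p2 _].
  have n2 : nu 2%:R = p%:R^-1 by rewrite -p2 pnorm_p.
  have lt2 : nu 4%:R < nu 2%:R.
    by rewrite (natrM _ 2 2) pnormM n2 gtr_pMr ?pRV_lt1 // invr_gt0 pR_gt0.
  move=> /eqP; rewrite sqrf_eq1 => /orP[] /eqP -> /eqP; rewrite sqrf_eq1;
    move=> /orP[] /eqP -> //.
    by rewrite opprK leNgt lt2.
  by rewrite -opprD pnormN leNgt lt2.
rewrite totient_prime // pnorm_p => w1 w'1 ww'.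
have p1 : (0 < p.-1)%N by rewrite -subn1 subn_gt0 prime_gt1.
have nw' := pnorm_root1 p1 w'1.
have w'0 : w' != 0.
  by apply: contra_eq_neq nw' => ->; rewrite pnorm0 eq_sym oner_neq0.
have uu : nu (w / w' - 1) = nu (w - w').
  by rewrite -{1}(divff w'0) -mulrBl pnormM pnormV nw' invr1 mulr1.
have : nu ((w / w') ^+ p.-1 - 1) = nu (w / w' - 1).
  apply: pnorm_subX1; first by rewrite uu (le_lt_trans ww') ?pRV_lt1.
  rewrite pnorm_coprime //.
  by rewrite gtnNdvd // prednK ?prime_gt0.
rewrite expr_div_n w1 w'1 divr1 subrr pnorm0 uu => /esym/pnorm_eq0/eqP.
by rewrite subr_eq0 => /eqP.
Qed.

Lemma pnorm_Fermat a : ~~ (p %| a)%N -> nu (a%:R ^+ p.-1 - 1) <= p%:R^-1.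
Proof.
move=> pa; have a1 : (0 < a ^ p.-1)%N.
  by rewrite expn_gt0; case: a pa => [|a]; rewrite ?dvdn0.
rewrite -natrX -(natrB _ a1) -[p%:R^-1]expr1 pnorm_dvd // expn1.
rewrite -eqn_mod_dvd // -totient_prime //; apply/eqP/Euler_exp_totient.
by rewrite coprime_sym prime_coprime.
Qed.

(** Evaluate [X^(p-1) - 1 = prod (X - z)] at a: by Fermat the product has norm below 1, so some root
    z is at distance below 1 from a, and [pnorm_subX1] improves this to 1/p. For p = 2, a modulo 4
    decides between 1 and -1. *)
Lemma teichmuller_ex a : ~~ (p %| a)%N ->
  exists w : K, w ^+ totient q = 1 /\ nu (w - a%:R) <= nu q%:R.
Proof.
rewrite /teichmuller_modulus => pa; case: eqP => [p2|/eqP p2].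
  have : ((a %% 4 == 1) || (a %% 4 == 3))%N.
    move: pa; rewrite p2; have := ltn_pmod a (isT : 0 < 4)%N.
    rewrite {2}(divn_eq a 4) dvdn_addr ?dvdn_mull //.
    by case: (a %% 4)%N => [|[|[|[|m]]]].
  have H (z : K) c : (a = 4 * (a %/ 4) + c)%N -> z - c%:R \in [:: 0; - 4%:R] ->
      nu (z - a%:R) <= nu 4%:R.
    move=> {1}-> zc; rewrite natrD opprD addrCA natrM addrC.
    apply: pnormB_le; last by rewrite pnormM ler_piMr ?pnorm_ge0 ?pnorm_nat_le1.
    move: zc; rewrite !inE => /orP[] /eqP ->; first by rewrite pnorm0 pnorm_ge0.
    by rewrite pnormN.
  move=> /orP[] /eqP a4; [exists 1|exists (- 1)].
    split; first by rewrite expr1n.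
    by apply: (H _ 1%N); rewrite ?subrr ?inE ?eqxx //; lia.
  split; first by rewrite (_ : totient 4 = 2) // sqrrN expr1n.
  apply: (H _ 3%N); first lia.
  by rewrite -opprD -(natrD _ 1 3) !inE eqxx orbT.
rewrite totient_prime // pnorm_p.
have p1 : (0 < p.-1)%N by rewrite -subn1 subn_gt0 prime_gt1.
have [rs [_ _ rsE XE]] := closed_unity_roots (natK_neq0 K p_prime p1).
have E : \prod_(z <- rs) (a%:R - z) = a%:R ^+ p.-1 - 1.
  have := congr1 (fun P : {poly K} => P.[a%:R]) XE.
  rewrite !hornerE horner_prod => ->; apply: eq_bigr => z _; by rewrite !hornerE.
have [z zrs az] : exists2 z, z \in rs & nu (a%:R - z) < 1.
  apply: contrapT => H.
  have : 1 <= nu (\prod_(z <- rs) (a%:R - z)).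
    rewrite big_seq; elim/big_ind: _ => [|x y x1 y1|z zrs].
    - by rewrite pnorm1.
    - by rewrite pnormM mulr_ege1.
    - by rewrite leNgt; apply/negP => az; apply: H; exists z.
  by rewrite E leNgt (le_lt_trans (pnorm_Fermat pa)) // pRV_lt1.
have z1 : z ^+ p.-1 = 1 by move: zrs; rewrite rsE => /unity_rootP.
have nz := pnorm_root1 p1 z1.
have z0 : z != 0.
  by apply: contra_eq_neq nz => ->; rewrite pnorm0 eq_sym oner_neq0.
have uu : nu (a%:R / z - 1) = nu (a%:R - z).
  by rewrite -{2}(divff z0) -mulrBl pnormM pnormV nz invr1 mulr1.
exists z; split=> //; rewrite pnorm_distC -uu -(@pnorm_subX1 _ p.-1) ?uu //.
  by rewrite expr_div_n z1 divr1 pnorm_Fermat.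
by rewrite pnorm_coprime // gtnNdvd // prednK ?prime_gt0.
Qed.

Lemma teichmullerP a : ~~ (p %| a)%N ->
  omega a ^+ totient q = 1 /\ nu (omega a - a%:R) <= nu q%:R.
Proof.
move=> pa; rewrite /teichmuller (negPf pa); exact: (xgetPex _ (teichmuller_ex pa)).
Qed.

Lemma teichmuller_unique a (w : K) : ~~ (p %| a)%N ->
  w ^+ totient q = 1 -> nu (w - a%:R) <= nu q%:R -> omega a = w.
Proof.
move=> pa w1 wa; have [o1 oa] := teichmullerP pa; apply: root_unity_close => //.
rewrite -[_ - w](subrKA a%:R) pnormD_le // pnorm_distC //.
Qed.

Lemma teichmullerM a b : omega (a * b)%N = omega a * omega b.
Proof.
have [/andP[pa pb]|] := boolP (~~ (p %| a)%N && ~~ (p %| b)%N); last first.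
  rewrite -negb_or -Euclid_dvdM // negbK /teichmuller => pab; rewrite pab.
  by move: pab; rewrite Euclid_dvdM // => /orP[] ->; rewrite ?mul0r ?mulr0.
have [wa1 wa] := teichmullerP pa; have [wb1 wb] := teichmullerP pb.
apply: teichmuller_unique; first by rewrite Euclid_dvdM // negb_or pa.
  by rewrite exprMn wa1 wb1 mulr1.
have -> : omega a * omega b - (a * b)%N%:R =
  (omega a - a%:R) * omega b + a%:R * (omega b - b%:R) by rewrite natrM; ring.
have t0 : (0 < totient q)%N by rewrite totient_gt0 teichmuller_modulus_gt0.
rewrite pnormD_le // pnormM; first by rewrite (pnorm_root1 t0 wb1) mulr1.
by rewrite (le_trans _ wb) // ler_piMl ?pnorm_ge0 ?pnorm_nat_le1.
Qed.

Lemma teichmuller_neq0 a : (omega a != 0) = ~~ (p %| a)%N.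
Proof.
case: (boolP (p %| a)%N) => pa; first by rewrite /teichmuller pa eqxx.
have [w1 _] := teichmullerP pa; apply: contra_eq_neq w1 => ->.
by rewrite expr0n gtn_eqF ?totient_gt0 ?teichmuller_modulus_gt0 // eq_sym oner_neq0.
Qed.

Lemma teichmuller1 : omega 1%N = 1.
Proof.
apply: teichmuller_unique; rewrite ?expr1n ?subrr ?pnorm0 ?pnorm_ge0 //.
by rewrite dvdn1 gtn_eqF ?prime_gt1.
Qed.

Lemma teichmuller_period a : omega (a + q)%N = omega a.
Proof.
have pq : (p %| q)%N by rewrite /teichmuller_modulus; case: eqP => // ->.
have [pa|pa] := boolP (p %| a)%N; first by rewrite /teichmuller dvdn_addl // pa.
have [w1 wa] := teichmullerP pa; apply: teichmuller_unique => //.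
  by rewrite dvdn_addl.
by rewrite natrD opprD addrA pnormB_le.
Qed.

Lemma teichmullerXz a (m : int) : ~~ (p %| a)%N -> ((totient q)%:Z %| m)%Z ->
  omega a ^ m = 1.
Proof.
move=> pa /dvdzP[t ->]; have [w1 _] := teichmullerP pa.
by rewrite mulrC -exprz_exp -[_ ^ _%:Z]/(_ ^+ _) w1 exp1rz.
Qed.

Lemma coprime_mul_modulus a f : coprime a (f * q) = coprime a (p * f).
Proof.
rewrite !coprimeMr coprime_teichmuller_modulus andbC.
by rewrite [coprime a p]coprime_sym (prime_coprime _ p_prime).
Qed.

Lemma twist_ex chi (m : int) : primitive_character chi ->
  exists theta, primitive_character theta /\
    forall a, coprime a (p * conductor chi)%N -> theta a = chi a * omega a ^ m.
Proof.
move=> /conductor_dchar; set f := conductor chi => dchi.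
(* The explicit zero matters when m = 0, since [omega a ^ 0] is 1 even at multiples of p. *)
pose eta a := if coprime a (f * q) then chi a * omega a ^ m else 0.
have deta : dirichlet_character (f * q) eta.
  rewrite /eta; split=> [|||a|a].
  - by rewrite muln_gt0 (dchar_gt0 dchi) teichmuller_modulus_gt0.
  - by rewrite coprime1n (dchar1 dchi) teichmuller1 exp1rz mulr1.
  - move=> a b; rewrite coprimeMl (dcharM dchi) teichmullerM expfzMl mulrACA.
    by do 2?case: coprime; rewrite ?mulr0 ?mul0r.
  - rewrite (@coprime_modP (a + f * q) a) ?modnDr // (dchar_periodM dchi).
    suff -> : omega (a + f * q) = omega a by [].
    elim: (f) => [|t IHt]; first by rewrite addn0.
    by rewrite mulSn addnCA addnC teichmuller_period.
  - case: ifP => [afq|]; last by rewrite eqxx.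
    move: afq; rewrite coprimeMr coprime_teichmuller_modulus => /andP[af pa].
    by rewrite mulf_neq0 ?expfz_neq0 ?teichmuller_neq0 ?(dchar_neq0 dchi).
have [d _ [theta ptheta E]] := dchar_inducing_primitive deta.
exists theta; split; first by exists d.
by move=> a; rewrite -coprime_mul_modulus => afq; rewrite E // /eta afq.
Qed.

Lemma twistP chi (m : int) : primitive_character chi ->
  primitive_character (teichmuller_twist chi m) /\
    forall a, coprime a (p * conductor chi)%N ->
      teichmuller_twist chi m a = chi a * omega a ^ m.
Proof. by move=> pchi; apply: (xgetPex _ (twist_ex m pchi)). Qed.

(** The twists cancel as primitive characters, hence at every integer and in particular at p, where
    the pointwise product gives no information. With exponents 1 - r and -n, this turns
    interpolation for [chi omega^(1-r)] into a formula about chi. *)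
Lemma twistK chi (m n : int) : primitive_character chi ->
  ((totient q)%:Z %| m + n)%Z ->
  teichmuller_twist (teichmuller_twist chi m) n = chi.
Proof.
move=> pchi mn; have [ppsi psiE] := twistP m pchi.
have [ptheta thetaE] := twistP n ppsi.
set psi := teichmuller_twist chi m in ppsi psiE ptheta thetaE *.
apply: (@primitive_character_ext _ _ _ (p * conductor chi * (p * conductor psi))) => //.
  by rewrite !muln_gt0 !conductor_gt0 // prime_gt0.
move=> a; rewrite coprimeMr => /andP[ac ap]; rewrite thetaE // psiE // -mulrA.
have pa : ~~ (p %| a)%N.
  by move: ac; rewrite coprimeMr coprime_sym prime_coprime // => /andP[].
by rewrite -expfzDr ?teichmuller_neq0 // teichmullerXz // mulr1.
Qed.

End Teichmuller.

(** * Power sums prime to p *)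

Lemma sum_blocks (V : nmodType) (G : nat -> V) (i0 f t : nat) :
  \sum_(i0 <= a < i0 + f * t) G a =
  \sum_(i0 <= b < i0 + f) \sum_(i < t) G (b + f * i)%N.
Proof.
elim: t => [|t IHt].
  rewrite muln0 addn0 big_geq // big1 // => b _; exact: big_ord0.
under [RHS]eq_bigr do rewrite big_ord_recr /=.
rewrite big_split -IHt /= mulnS addnA (@big_cat_nat _ _ _ (i0 + f * t)) /=;
  last 2 first.
- exact: leq_addr.
- by rewrite leq_add2r leq_addr.
by rewrite big_addn addnK.
Qed.

(** The slack s encodes [m' = ceil(m / l)]: no multiple of l lies between m and l m' - 1. *)
Lemma sum_multiples (V : nmodType) (G : nat -> V) (l m m' s : nat) :
  (m + s = l * m')%N -> (s < l)%N ->
  \sum_(0 <= j < m | (l %| j)%N) G j = \sum_(0 <= i < m') G (l * i)%N.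
Proof.
move=> ms sl; have -> : \sum_(0 <= j < m | (l %| j)%N) G j =
    \sum_(0 <= j < l * m' | (l %| j)%N) G j.
  rewrite -ms [RHS](@big_cat_nat _ _ _ m) ?leq_addr //= [X in _ + X]big1_seq ?addr0 //.
  move=> j /andP[/dvdnP[c ->]]; rewrite mem_index_iota ms => /andP[mc].
  rewrite mulnC ltn_mul2l => /andP[_ cm'].
  suff : (l * m' <= c * l + s)%N by nia.
  by rewrite -ms leq_add2r.
have l0 : (0 < l)%N by apply: leq_ltn_trans sl.
elim: m' {m s ms sl} => [|m IHm] /=; first by rewrite muln0 !big_nil.
rewrite big_nat_recr //= -IHm mulnS addnC (@big_cat_nat _ _ _ (l * m)) ?leq_addr //=.
rewrite [X in _ + X]big_ltn_cond ?dvdn_mulr //; last lia.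
rewrite [X in _ + (_ + X)]big1_seq ?addr0 // => j /andP[/dvdnP[c ->]].
rewrite mem_index_iota [(c * l)%N]mulnC ltn_mul2l l0 /= => /andP[mc].
by rewrite -mulnSr ltn_mul2l l0 ltnS leqNgt mc.
Qed.

Section Powers.
Variables (R : realType) (p : nat) (K : padic_closure R p).
Hypothesis p_prime : prime p.
Implicit Types (a b d f m n t : nat).
Local Notation nu := (@pnorm R p K).
Local Notation q := (teichmuller_modulus p).

Lemma pnorm_pow_totient a t n : ~~ (p %| a)%N -> (totient q * p ^ t %| n)%N ->
  nu (a%:R ^+ n - 1) <= p%:R^-1 ^+ t.
Proof.
move=> pa /dvdnP[c ->]; have a0 : (0 < a)%N by case: a pa; rewrite ?dvdn0.
have a1 : (0 < a ^ (c * (totient q * p ^ t)))%N by rewrite expn_gt0 a0.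
rewrite -natrX -(natrB _ a1) pnorm_dvd // -eqn_mod_dvd //; apply/eqP.
have ap : coprime a (p ^ t) by rewrite coprimeXr // coprime_sym prime_coprime.
suff /dvdnP[d ->] : (totient (p ^ t) %| c * (totient q * p ^ t))%N.
  by rewrite mulnC expnM -modnXm Euler_exp_totient // modnXm exp1n.
apply: dvdn_mull; case: t ap {a1} => [|t] _;
  first by rewrite expn0 (_ : totient 1 = 1)%N.
rewrite totient_pfactor // expnS; apply: dvdn_mul; last exact: dvdn_mull.
by rewrite /teichmuller_modulus; case: eqP => [->|_] //; rewrite totient_prime.
Qed.

Lemma natK_unit a : ~~ (p %| a)%N -> a%:R != 0 :> K.
Proof. by move=> pa; rewrite natK_neq0 //; case: a pa; rewrite ?dvdn0. Qed.

Lemma pnorm_powz_totient a t (i : int) : ~~ (p %| a)%N ->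
  ((totient q * p ^ t)%:Z %| i)%Z -> nu (a%:R ^ i - 1) <= p%:R^-1 ^+ t.
Proof.
move=> pa; rewrite dvdzE absz_nat => ti.
have := pnorm_pow_totient pa ti; case: (intP i) => [|n|n]; rewrite ?absz0 //.
rewrite abszN absz_nat -exprnN => H.
have -> : a%:R ^- n.+1 - 1 = - ((a%:R ^+ n.+1 - 1) / a%:R ^+ n.+1) :> K.
  by rewrite mulrBl divff ?expf_neq0 ?natK_unit // opprB mul1r.
by rewrite pnormN pnormM pnormV pnormX pnorm_coprime // expr1n invr1 mulr1.
Qed.

Lemma pnorm_powz a (i : int) : ~~ (p %| a)%N -> nu (a%:R ^ i) = 1.
Proof.
by move=> pa; case: i => n; rewrite ?NegzE -?exprnN ?pnormV -?exprnP pnormX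
  pnorm_coprime // expr1n ?invr1.
Qed.

Lemma pnorm_powz_close a t (i j : int) : ~~ (p %| a)%N ->
  ((totient q * p ^ t)%:Z %| i - j)%Z ->
  nu (a%:R ^ i - a%:R ^ j) <= p%:R^-1 ^+ t.
Proof.
move=> pa ij; have -> : a%:R ^ i - a%:R ^ j = a%:R ^ j * (a%:R ^ (i - j) - 1) :> K.
  by rewrite mulrBr mulr1 -expfzDr ?natK_unit // [j + _]addrC subrK.
by rewrite pnormM pnorm_powz // mul1r pnorm_powz_totient.
Qed.

Definition power_sum (r : int) n : K :=
  \sum_(1 <= j < n | ~~ (p %| j)%N) j%:R ^ (- r).

Lemma power_sum_close (r r' : int) t n :
  ((totient q * p ^ t)%:Z %| r - r')%Z ->
  nu (power_sum r n - power_sum r' n) <= p%:R^-1 ^+ t.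
Proof.
move=> rr'; rewrite -sumrB; apply: pnorm_sum_le => [|j pj].
  by rewrite ltW // pRVX_gt0.
by apply: pnorm_powz_close => //; rewrite -opprD rpredN.
Qed.

Definition bernoulli_polyK n : {poly K} := map_poly (ratp K p_prime) (bernoulli_poly n).
Local Notation bernK := bernoulli_polyK.

Lemma bernK_nat n m : (bernK n).[m%:R] = ratp K p_prime (bernoulli_poly n).[m%:R].
Proof. by rewrite -horner_map rmorph_nat. Qed.

Lemma power_sum_bernoulli n m m' s : (0 < n)%N -> (0 < m)%N ->
  (m + s = p * m')%N -> (s < p)%N ->
  n%:R * power_sum (1 - n%:Z) m =
    ((bernK n).[m%:R] - (bernK n).[0]) -
    p%:R ^+ n.-1 * ((bernK n).[m'%:R] - (bernK n).[0]).
Proof.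
move=> n0 m0 ms sp.
(* The sums start at 0 to fit [sum_exprn_bernoulli]. For n = 1 the term [0 ^ 0 = 1] occurs both in
   the full sum and among the multiples of p, and cancels. *)
pose S m : K := \sum_(0 <= j < m) j%:R ^+ n.-1.
have SE k : n%:R * S k = (bernK n).[k%:R] - (bernK n).[0].
  rewrite bernK_nat -[0]/(0%:R) bernK_nat -rmorphB /= bernoulli_poly0.
  rewrite -sum_exprn_bernoulli rmorphM rmorph_nat rmorph_sum; congr (_ * _).
  by apply: eq_bigr => j _; rewrite rmorphXn /= rmorph_nat.
rewrite -!SE mulrCA -mulrBr; congr (_ * _).
rewrite /S mulr_sumr [in RHS](bigID (fun j => p %| j)%N) /=.
rewrite (sum_multiples _ ms sp).
have -> : \sum_(0 <= i < m') p%:R ^+ n.-1 * i%:R ^+ n.-1 =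
    \sum_(0 <= i < m') (p * i)%:R ^+ n.-1 :> K.
  by apply: eq_bigr => i _; rewrite natrM exprMn.
rewrite addrAC subrr add0r [RHS]big_ltn_cond // dvdn0 /=.
apply: eq_bigr => j _.
by rewrite opprB (_ : n%:Z - 1 = n.-1%:Z) //; lia.
Qed.

End Powers.

(** * Generalized Bernoulli numbers *)

Section GeneralizedBernoulli.
Variables (R : realType) (p : nat) (K : padic_closure R p).
Hypothesis p_prime : prime p.
Implicit Types (chi psi theta : nat -> K) (a b d f m n t M N : nat).
Local Notation nu := (@pnorm R p K).
Local Notation natp := (natK_neq0 K p_prime).
Local Notation bernK n := (bernoulli_polyK K p_prime n).

(** [B_{n,chi}] computed from a period M of chi that need not be its conductor. *)
Definition bernoulli_sum n M chi : K :=
  M%:R ^+ n.-1 * \sum_(1 <= a < M.+1) chi a * (bernK n).[a%:R / M%:R].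

Lemma generalized_bernoulliE n chi : (0 < n)%N ->
  generalized_bernoulli chi n = bernoulli_sum n (conductor chi) chi.
Proof.
move=> n0; rewrite /generalized_bernoulli /bernoulli_sum.
rewrite (_ : n%:Z - 1 = n.-1%:Z); last lia.
congr (_ * _); apply: eq_bigr => a _; congr (_ * _).
rewrite -[LHS]/(ratp K p_prime _) -horner_map /=.
by rewrite fmorph_div !rmorph_nat.
Qed.

Lemma bernK_distribution n M x : (0 < M)%N ->
  M%:R ^+ n * (\sum_(i < M) (bernK n).[(ratp K p_prime x + i%:R) / M%:R]) =
  M%:R * (bernK n).[ratp K p_prime x].
Proof.
move=> /(bernoulli_poly_distribution n x)/(congr1 (ratp K p_prime)).
rewrite !rmorphM rmorphXn rmorph_nat rmorph_sum /= -horner_map => <-.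
congr (_ * _); apply: eq_bigr => i _.
by rewrite -horner_map /= fmorph_div rmorphD !rmorph_nat.
Qed.

(** Writing a = b + f i, the sum over i is the distribution relation of level t at b / f. *)
Lemma bernoulli_sum_multiple n f t chi : (0 < n)%N -> (0 < f)%N -> (0 < t)%N ->
  (forall a, chi (a + f)%N = chi a) ->
  bernoulli_sum n (f * t) chi = bernoulli_sum n f chi.
Proof.
move=> n0 f0 t0 chi_f; rewrite /bernoulli_sum.
have chi_fi a i : chi (a + f * i)%N = chi a.
  elim: i => [|i IHi]; first by rewrite muln0 addn0.
  by rewrite mulnS addnCA addnC chi_f.
rewrite -[(f * t).+1]add1n sum_blocks add1n natrM exprMn -mulrA; congr (_ * _).
rewrite mulr_sumr; apply: eq_bigr => b _.
have E : t%:R ^+ n * (\sum_(i < t) (bernK n).[(b + f * i)%:R / (f%:R * t%:R)]) =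
    t%:R * (bernK n).[b%:R / f%:R].
  have := bernK_distribution n (b%:R / f%:R) t0.
  rewrite fmorph_div !rmorph_nat => <-; congr (_ * _); apply: eq_bigr => i _.
  congr _.[_]; rewrite natrD natrM; field.
  by rewrite !natp.
under eq_bigr do rewrite chi_fi.
rewrite -mulr_sumr mulrCA; congr (_ * _).
apply: (mulfI (natp t0)); rewrite -E mulrA; congr (_ * _).
by rewrite -exprS prednK.
Qed.

(** Induction on the primes. With M = l M', the terms divisible by l are a = l b with
    [a / M = b / M'], and they add up to [chi(l) l^(n-1)] times the same sum at level M'. The
    divisibility hypothesis lets the induction hypothesis apply at both levels. *)
Lemma bernoulli_sum_sieve n f s M chi : (0 < n)%N -> (0 < f)%N ->
  (forall a, chi (a + f)%N = chi a) -> (forall a b, chi (a * b)%N = chi a * chi b) ->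
  all prime s -> uniq s -> (0 < M)%N -> (f * \prod_(l <- s) l %| M)%N ->
  bernoulli_sum n M (fun a => if all (fun l => ~~ (l %| a)%N) s then chi a else 0) =
  \prod_(l <- s) (1 - chi l * l%:R ^+ n.-1) * bernoulli_sum n f chi.
Proof.
move=> n0 f0 chi_f chiM; elim: s M => [|l s IHs] M /=.
  rewrite !big_nil muln1 mul1r => _ _ M0 /dvdnP[t Mt].
  rewrite Mt mulnC bernoulli_sum_multiple //.
  by case: t Mt M0 => // ->.
move=> /andP[l_pr s_pr] /andP[ls us] M0; rewrite big_cons => fM.
pose chi_s a := if all (fun l => ~~ (l %| a)%N) s then chi a else 0.
have fM' : (f * \prod_(j <- s) j %| M)%N.
  by apply: dvdn_trans fM; rewrite mulnCA dvdn_mull.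
have [M' MM'] : exists M', M = (l * M')%N.
  have /dvdnP[M' ->] : (l %| M)%N.
    by apply: dvdn_trans fM; rewrite mulnCA dvdn_mulr.
  by exists M'; rewrite mulnC.
have l0 := prime_gt0 l_pr.
have M'0 : (0 < M')%N by case: M' MM' M0 => // ->; rewrite muln0.
have fM'' : (f * \prod_(j <- s) j %| M')%N.
  by move: fM; rewrite MM' mulnCA dvdn_pmul2l.
have IH := IHs M s_pr us M0 fM'.
have IH' := IHs M' s_pr us M'0 fM''.
rewrite big_cons -mulrA mulrBl mul1r -{1}IH -IH' -/chi_s.
have -> : bernoulli_sum n M chi_s = bernoulli_sum n M
     (fun a => if ~~ (l %| a)%N && all (fun l => ~~ (l %| a)%N) s then chi a else 0)
   + bernoulli_sum n M (fun a => if (l %| a)%N then chi_s a else 0).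
  rewrite /bernoulli_sum -mulrDr -big_split; congr (_ * _); apply: eq_bigr => a _ /=.
  by rewrite -mulrDl /chi_s; case: (l %| a)%N; rewrite /= ?add0r ?addr0.
suff -> : bernoulli_sum n M (fun a => if (l %| a)%N then chi_s a else 0) =
    chi l * l%:R ^+ n.-1 * bernoulli_sum n M' chi_s by rewrite addrK.
rewrite /bernoulli_sum.
under eq_bigr do rewrite (fun_if (fun x => x * _)) mul0r.
rewrite -big_mkcond.
pose G a := chi_s a * (bernK n).[a%:R / M%:R].
(* The range a <= M ends before M + 1, and [ceil((M + 1) / l) = M' + 1] with slack l - 1. The term a
   = 0, absent from [bernoulli_sum], is cancelled on both sides. *)
have lM' : (M.+1 + l.-1 = l * M'.+1)%N by rewrite MM' mulnS; lia.
have /= := sum_multiples G lM'; rewrite prednK // => /(_ (leqnn _)).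
rewrite big_ltn_cond // dvdn0 [in X in _ = X -> _]big_ltn // muln0 => /addrI ->.
rewrite MM' natrM exprMn [chi l * _]mulrC -!mulrA; congr (_ * _).
rewrite mulrCA; congr (_ * _).
rewrite mulr_sumr; apply: eq_bigr => b _; rewrite /G mulrA; congr (_ * _).
  rewrite /chi_s chiM.
  have -> : all (fun j => ~~ (j %| l * b)%N) s = all (fun j => ~~ (j %| b)%N) s.
    apply: eq_in_all => j js; have j_pr := allP s_pr j js; rewrite Euclid_dvdM //.
    suff /negPf -> : ~~ (j %| l)%N by [].
    by rewrite dvdn_prime2 //; apply: contraNN ls => /eqP <-.
  by case: ifP => // _; rewrite mulr0.
congr _.[_]; rewrite MM' !natrM; field.
by rewrite !natp.
Qed.

Lemma coprime_all_primes a N : (0 < N)%N ->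
  coprime a N = all (fun l => ~~ (l %| a)%N) (primes N).
Proof.
move=> N0; apply/idP/allP => [aN l|H].
  rewrite mem_primes => /and3P[l_pr _ lN]; rewrite -prime_coprime // coprime_sym.
  exact: coprime_dvdr aN.
apply: contraT => naN.
have g1 : (1 < gcdn a N)%N by rewrite ltn_neqAle eq_sym naN gcdn_gt0 N0 orbT.
have := H (pdiv (gcdn a N)).
rewrite mem_primes pdiv_prime // N0 !(dvdn_trans (pdiv_dvd _)) ?dvdn_gcdl ?dvdn_gcdr //.
by move/(_ isT).
Qed.

Lemma euler_factors_bernoulli n f N chi : (0 < n)%N -> (0 < N)%N -> (f %| N)%N ->
  dirichlet_character f chi ->
  \prod_(l <- primes N) (1 - chi l * l%:R ^+ n.-1) * bernoulli_sum n f chi =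
  N%:R ^+ n.-1 *
    \sum_(1 <= a < N.+1 | coprime a N) chi a * (bernK n).[a%:R / N%:R].
Proof.
move=> n0 N0 fN dchi; have f0 := dchar_gt0 dchi.
(* N need not be divisible by f times the product of its primes, as the sieve requires. The sieve is
   run at this multiple of N; the sieved function has period N, which brings the sum back to level
   N. *)
pose M := (N * (f * \prod_(l <- primes N) l))%N.
have Pr0 : (0 < \prod_(l <- primes N) l)%N.
  rewrite big_seq; elim/big_ind: _ => // [x y x0 y0|l]; first by rewrite muln_gt0 x0.
  by rewrite mem_primes => /andP[/prime_gt0].
have M0 : (0 < M)%N by rewrite !muln_gt0 N0 f0.
rewrite -(@bernoulli_sum_sieve n f _ M) //; first last.
- exact: dvdn_mull.
- exact: primes_uniq.
- by apply/allP => l; rewrite mem_primes => /andP[].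
- exact: dcharM dchi.
- by case: dchi.
rewrite bernoulli_sum_multiple // ?muln_gt0 ?f0 //.
  rewrite /bernoulli_sum [in RHS]big_mkcond; congr (_ * _); apply: eq_bigr => a _.
  by rewrite -coprime_all_primes // (fun_if (fun x => x * _)) mul0r.
move=> a; rewrite -!coprime_all_primes // (@coprime_modP (a + N) a) ?modnDr //.
by case/dvdnP: fN => t ->; rewrite mulnC (dchar_periodM dchi).
Qed.

End GeneralizedBernoulli.

(** * The character sum at r = 1 - n *)

Lemma totient_prod (F : fieldType) N : (0 < N)%N ->
  (forall l, prime l -> (l %| N)%N -> l%:R != 0 :> F) ->
  (totient N)%:R = N%:R * \prod_(l <- primes N) (1 - l%:R^-1) :> F.
Proof.
move=> N0 H; rewrite totientE // natr_prod.
have -> : N%:R = \prod_(l <- primes N) (l ^ logn l N)%:R :> F.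
  rewrite -natr_prod; congr _%:R; rewrite {1}(prod_prime_decomp N0).
  by rewrite prime_decompE big_map.
rewrite -big_split /= !big_seq; apply: eq_bigr => l.
rewrite mem_primes => /and3P[l_pr _ lN]; have l0 := prime_gt0 l_pr.
have : (0 < logn l N)%N by rewrite logn_gt0 mem_primes l_pr N0.
case: (logn l N) => // e _; rewrite /= natrM natrX expnS natrM natrX -subn1 natrB //.
by field; apply: H.
Qed.

Section FiniteIdentity.
Variables (R : realType) (p : nat) (K : padic_closure R p).
Hypothesis p_prime : prime p.
Implicit Types (chi psi theta : nat -> K) (a b d f m n t : nat).
Local Notation natp := (natK_neq0 K p_prime).
Local Notation bernK n := (bernoulli_polyK K p_prime n).
Variable N : nat.
Hypotheses (N_gt1 : (1 < N)%N) (N_p : coprime N p).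
Let N0 : (0 < N)%N := ltnW N_gt1.
Local Notation pchars := [set chi : nat -> K | primitive_character chi /\
                                        (conductor chi %| N)%N].

(* The quantity L_value for r = 1 - n, with the p-adic L-function replaced by
   its interpolation formula at 1 - n. *)
Definition L_neg n chi : K :=
  (\prod_(l <- primes N) (1 - chi l * l%:R ^+ n.-1) -
   (if conductor chi == 1%N
    then N%:R ^+ n * \prod_(l <- primes N) (1 - l%:R^-1) else 0)) *
  - ((1 - chi p * p%:R ^+ n.-1) * generalized_bernoulli chi n / n%:R).

Lemma sum_mod_inverse (G : nat -> K) y k : (0 < k < N)%N -> coprime k N ->
  (y * k = 1 %[mod N])%N ->
  \sum_(1 <= a < N.+1 | coprime a N)
     (if y * a == 1 %[mod N] then (totient N)%:R else 0) * G a =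
  (totient N)%:R * G k.
Proof.
move=> /andP[k0 kN] kcop yk.
rewrite big_mkcond (bigD1_seq k) ?iota_uniq ?mem_index_iota ?k0 ?ltnS ?(ltnW kN) //=.
rewrite kcop yk eqxx big1_seq ?addr0 // => a /andP[ak]; rewrite mem_index_iota.
move=> /andP[a0 aN]; case: ifP => // acop; case: eqP => [ya|]; last by rewrite mul0r.
suff /eqP E : a = k %[mod N].
  case/negP: ak; move: E; rewrite (modn_small kN); move: aN.
  rewrite ltnS leq_eqVlt => /orP[/eqP -> |/modn_small -> //].
  by rewrite modnn => /eqP E; move: k0; rewrite -E.
have -> : (a = y * k * a %[mod N])%N by rewrite -modnMml yk modnMml mul1n.
by rewrite mulnAC -modnMml ya modnMml mul1n.
Qed.

(** The values at 0 and 1 differ only for n = 1, where the factor [1 - p ^ 0] vanishes. This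
    reconciles the trivial character, whose Bernoulli number is [B_n(1)], with the power sums, which
    involve [B_n(0)]. *)
Lemma bernK01 n : (0 < n)%N ->
  (1 - p%:R ^+ n.-1) * (bernK n).[1] = (1 - p%:R ^+ n.-1) * (bernK n).[0].
Proof.
move=> n0; have -> : (bernK n).[1] = ratp K p_prime (bernoulli_poly n).[1].
  exact: (bernK_nat K p_prime n 1).
have -> : (bernK n).[0] = ratp K p_prime (bernoulli_poly n).[0].
  exact: (bernK_nat K p_prime n 0).
rewrite bernoulli_poly1 bernoulli_poly0 rmorphD /= mulrDr.
by case: n n0 => [|[|n]] //= _;
  rewrite ?rmorph0 ?mulr0 ?addr0 // expr0 subrr !mul0r addr0.
Qed.

Lemma sum_L_neg n k k' : (0 < n)%N -> (0 < k < N)%N -> coprime k N ->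
  (0 < k' < N)%N -> (p * k' = k %[mod N])%N ->
  \sum_(chi \in pchars) (chi k)^-1 * L_neg n chi =
  - ((totient N)%:R * N%:R ^+ n.-1 / n%:R) *
  ((bernK n).[k%:R / N%:R] - p%:R ^+ n.-1 * (bernK n).[k'%:R / N%:R] -
   (1 - p%:R ^+ n.-1) * (bernK n).[0]).
Proof.
move=> n0 kN kcop k'N pk'.
have pN : coprime p N by rewrite coprime_sym.
have k'cop : coprime k' N.
  by have := coprime_modP pk'; rewrite coprimeMl kcop pN.
have [c ccop kc] := modn_invertible kcop N0.
have ck : (c * k = 1 %[mod N])%N by rewrite mulnC.
have cpk' : (c * p * k' = 1 %[mod N])%N by rewrite -mulnA -modnMmr pk' modnMmr.
pose G a := (bernK n).[a%:R / N%:R].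
pose C := (totient N)%:R * N%:R ^+ n.-1 * ((1 - p%:R ^+ n.-1) * (bernK n).[0]).
(* Since c inverts k modulo N, expanding [chi(c) (1 - chi(p) p^(n-1)) chi(a)] gives chi at c a and
   at c p a; orthogonality will select a = k in the first and a = k' in the second. The constant C
   comes from [N^n prod (1 - 1/l) = N^(n-1) totient N]. *)
have termE chi : pchars chi -> (chi k)^-1 * L_neg n chi = - n%:R^-1 *
    (N%:R ^+ n.-1 * (\sum_(1 <= a < N.+1 | coprime a N)
      (chi (c * a)%N - p%:R ^+ n.-1 * chi (c * p * a)%N) * G a) -
     (if chi == @trivial_character R p K then C else 0)).
  move=> [pchi fN]; have dchi := conductor_dchar pchi.
  have chik : (chi k)^-1 = chi c.
    have cc : chi c * chi k = 1.
      have dN := dchar_extend_modulus N0 fN dchi.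
      have := dchar_eq_mod dN ck; rewrite /extend_modulus coprime1n coprimeMl ccop kcop.
      by rewrite /= (dcharM dchi) (dchar1 dchi).
    have chik0 : chi k != 0.
      by apply: contra_eq_neq cc => ->; rewrite mulr0 eq_sym oner_neq0.
    by apply: (mulIf chik0); rewrite mulVf // cc.
  have -> : \sum_(1 <= a < N.+1 | coprime a N)
      (chi (c * a)%N - p%:R ^+ n.-1 * chi (c * p * a)%N) * G a =
      chi c * (1 - chi p * p%:R ^+ n.-1) *
      \sum_(1 <= a < N.+1 | coprime a N) chi a * G a.
    rewrite mulr_sumr; apply: eq_bigr => a _; rewrite !(dcharM dchi); ring.
  have := euler_factors_bernoulli p_prime n0 N0 fN dchi.
  rewrite -generalized_bernoulliE // -/G /L_neg chik.
  set S := \sum_(_ <= _ < _ | _) _; set B := generalized_bernoulli _ _.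
  set Pr := \prod_(_ <- _) (1 - chi _ * _) => E.
  have -> : (if conductor chi == 1%N
      then N%:R ^+ n * \prod_(l <- primes N) (1 - l%:R^-1) else 0) =
      (if chi == @trivial_character R p K
       then N%:R ^+ n.-1 * (totient N)%:R else 0) :> K.
    rewrite (totient_prod N0); last by move=> l /prime_gt0/natp.
    rewrite mulrA -exprSr prednK //.
    suff -> : (conductor chi == 1%N) = (chi == @trivial_character R p K) by [].
    apply/eqP/eqP => [|->]; first exact: conductor1_trivial.
    exact/conductorE/primitive_trivial.
  case: eqP => [chi1|_]; last first.
    rewrite !subr0; have -> : N%:R ^+ n.-1 * (chi c * (1 - chi p * p%:R ^+ n.-1) * S)
      = chi c * (1 - chi p * p%:R ^+ n.-1) * (Pr * B) by rewrite E; ring.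
    by ring.
  have -> : C = (totient N)%:R * N%:R ^+ n.-1 * ((1 - p%:R ^+ n.-1) * B).
    rewrite /C -bernK01 // /B generalized_bernoulliE // chi1.
    rewrite (conductorE (primitive_trivial K)) /bernoulli_sum big_nat1.
    rewrite mulr1n expr1n.
    by rewrite divr1 /trivial_character !mul1r.
  have chi_1 a : chi a = 1 by rewrite chi1.
  rewrite !chi_1 !mul1r; have -> : N%:R ^+ n.-1 * ((1 - p%:R ^+ n.-1) * S)
      = (1 - p%:R ^+ n.-1) * (Pr * B) by rewrite E; ring.
  by ring.
have finA := finite_pchars K p_prime N0.
rewrite fsbig_finite //=.
pose T chi := - n%:R^-1 *
    (N%:R ^+ n.-1 * (\sum_(1 <= a < N.+1 | coprime a N)
      (chi (c * a)%N - p%:R ^+ n.-1 * chi (c * p * a)%N) * G a) -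
     (if chi == @trivial_character R p K then C else 0)).
rewrite (eq_big_seq T); last first.
  by move=> chi; rewrite in_fset_set // inE => /termE.
rewrite /T -mulr_sumr sumrB -mulr_sumr exchange_big /=.
have -> : \sum_(chi <- fset_set pchars)
    (if chi == @trivial_character R p K then C else 0) = C.
  rewrite (bigD1_seq (@trivial_character R p K)) ?fset_uniq //=.
    by rewrite eqxx big1 ?addr0 // => chi /negPf ->.
  rewrite in_fset_set // inE /=; split; first by exists 1%N; apply: primitive_trivial.
  by rewrite (conductorE (primitive_trivial K)).
have -> : \sum_(1 <= a < N.+1 | coprime a N) \sum_(chi <- fset_set pchars)
      (chi (c * a)%N - p%:R ^+ n.-1 * chi (c * p * a)%N) * G a =
    (totient N)%:R * G k - p%:R ^+ n.-1 * ((totient N)%:R * G k').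
  rewrite -(sum_mod_inverse G kN kcop ck) -(sum_mod_inverse G k'N k'cop cpk').
  rewrite mulr_sumr -sumrB; apply: eq_bigr => a acop.
  rewrite -mulr_suml sumrB -mulr_sumr -!fsbig_finite //.
  by rewrite !sum_pchars ?coprimeMl ?ccop ?pN //; ring.
by rewrite /C /G; ring.
Qed.

End FiniteIdentity.

(** * The residue at 1 *)

Section BernoulliLimit.
Variables (R : realType) (p : nat) (K : padic_closure R p).
Hypothesis p_prime : prime p.
Implicit Types (a b d f k m n t : nat).
Local Notation nu := (@pnorm R p K).
Local Notation natp := (natK_neq0 K p_prime).
Local Notation bernK n := (bernoulli_polyK K p_prime n).
Local Notation B k := (ratp K p_prime (bernoulli k)).
Local Notation "u ~> l" := (tends_to nu u l) (at level 70).

(** Because |1/(d+1)| is at most d + 1, and d + 1 is at most p^d. *)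
Lemma pnorm_pX_div d : nu (p%:R ^+ d / d.+1%:R) <= 1.
Proof.
rewrite pnormM pnormX pnorm_p.
apply: le_trans (ler_wpM2l _ (pnorm_natV K p_prime (ltn0Sn d))) _.
  by rewrite ltW // pRVX_gt0.
rewrite exprVn ler_pdivrMl ?exprn_gt0 ?pR_gt0 // mulr1 -natrX ler_nat.
by rewrite ltn_expl ?prime_gt1.
Qed.

Lemma horner_bernK n x : (bernK n).[x] =
  \sum_(k < n.+1) 'C(n, k)%:R * B k * x ^+ (n - k).
Proof.
rewrite /bernoulli_polyK /bernoulli_poly rmorph_sum /= horner_sum;
  apply: eq_bigr => k _.
by rewrite map_polyZ /= map_polyXn hornerZ hornerXn rmorphM /= rmorph_nat.
Qed.

Lemma bernK0 n : (bernK n).[0] = B n.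
Proof. by rewrite (bernK_nat K p_prime n 0 : _.[0] = _) bernoulli_poly0. Qed.

(* A weak form of the von Staudt-Clausen theorem. *)
Lemma pnorm_p_bernoulli k : nu (p%:R * B k) <= 1.
Proof.
have [m] := ubnP k; elim: m k => // m IHm k; rewrite ltnS => km.
(* The power sum formula at m = p, divided by k + 1: [p B_k] is the term i = k, and each other term
   is an integer times [p B_i] times [p^(k-i) / (k-i+1)], integral by induction and
   [pnorm_pX_div]. *)
have E : \sum_(0 <= j < p) j%:R ^+ k = p%:R * B k +
    \sum_(i < k) 'C(k, i)%:R * (p%:R * B i) * (p%:R ^+ (k - i) / (k - i).+1%:R).
  apply: (mulfI (natp (ltn0Sn k))).
  have := congr1 (ratp K p_prime) (sum_exprn_bernoulli k.+1 p).
  rewrite rmorphM rmorph_nat rmorph_sum rmorphB /= -bernK_nat horner_bernK.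
  rewrite big_ord_recr /= subnn expr0 mulr1 binn mul1r addrK big_ord_recr /=.
  rewrite binSn subSnn expr1 => S;
    under eq_bigr do rewrite -(rmorph_nat (ratp K p_prime)) -rmorphXn.
  rewrite S addrC mulrDr; congr (_ + _); first by ring.
  rewrite mulr_sumr; apply: eq_bigr => i _; rewrite subSn 1?ltnW // exprS.
  have bin : k.+1%:R * 'C(k, i)%:R = (k - i).+1%:R * 'C(k.+1, i)%:R :> K.
    by rewrite -!natrM mul_bin_down subSn // ltnW.
  have -> : 'C(k.+1, i)%:R = k.+1%:R * 'C(k, i)%:R / (k - i).+1%:R :> K.
    by rewrite bin mulrC mulKf // natp.
  by ring.
have -> : p%:R * B k = \sum_(0 <= j < p) j%:R ^+ k -
    \sum_(i < k) 'C(k, i)%:R * (p%:R * B i) * (p%:R ^+ (k - i) / (k - i).+1%:R).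
  by rewrite E addrK.
apply: pnormB_le; apply: pnorm_sum_le => //.
  by move=> j _; rewrite -natrX pnorm_nat_le1.
move=> i _.
rewrite pnormM mulr_ile1 ?pnorm_ge0 ?pnorm_pX_div // pnormM.
by rewrite mulr_ile1 ?pnorm_ge0 ?pnorm_nat_le1 // IHm // (leq_trans _ km).
Qed.

(** The identity [C(n,k) = (n/k) C(n-1,k-1)] extracts the factor n; what remains is a binomial times
    [p B_k] times [p^(k-1) / k], all integral. *)
Lemma pnorm_bin_bernoulli n k : (0 < k <= n)%N ->
  nu ('C(n, k)%:R * B k * p%:R ^+ k) <= nu n%:R.
Proof.
case: n k => [|n] [|k] //= kn.
have -> : 'C(n.+1, k.+1)%:R = n.+1%:R * 'C(n, k)%:R / k.+1%:R :> K.
  by rewrite -natrM mul_bin_diag natrM mulrC mulKf // natp.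
have -> : n.+1%:R * 'C(n, k)%:R / k.+1%:R * B k.+1 * p%:R ^+ k.+1 =
    n.+1%:R * ('C(n, k)%:R * ((p%:R * B k.+1) * (p%:R ^+ k / k.+1%:R))).
  by rewrite exprS; ring.
rewrite pnormM ler_piMr ?pnorm_ge0 // pnormM mulr_ile1 ?pnorm_ge0 ?pnorm_nat_le1 //.
by rewrite pnormM mulr_ile1 ?pnorm_ge0 ?pnorm_p_bernoulli ?pnorm_pX_div.
Qed.

(* The distribution relation of level p at 0, in which the term i = 0 is B_n
   itself and produces the Euler factor. *)
Lemma bernoulli_euler_factor n : (0 < n)%N ->
  nu (p%:R * ((1 - p%:R ^+ n.-1) * B n) - \sum_(1 <= i < p) i%:R ^+ n) <= nu n%:R.
Proof.
move=> n0; have p0 := prime_gt0 p_prime.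
have pn : p%:R * p%:R ^+ n.-1 = p%:R ^+ n :> K by rewrite -exprS prednK.
have -> : p%:R * ((1 - p%:R ^+ n.-1) * B n) =
    p%:R ^+ n * \sum_(1 <= i < p) (bernK n).[i%:R / p%:R].
  have := bernK_distribution K p_prime n 0 p0.
  rewrite rmorph0 bernK0 -(big_mkord predT (fun i => (bernK n).[(0 + i%:R) / p%:R])).
  rewrite big_ltn // add0r mul0r bernK0 mulrDr => E.
  rewrite mulrA mulrBr mulr1 pn mulrBl -E addrC addKr; congr (_ * _).
  by apply: eq_bigr => i _; rewrite add0r.
rewrite mulr_sumr -sumrB; apply: pnorm_sum_le => [|i _]; first exact: pnorm_ge0.
(* In [p^n B_n(i/p)] the term k = 0 is exactly [i^n]; the terms k >= 1 are bounded by
   [pnorm_bin_bernoulli]. *)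
rewrite horner_bernK mulr_sumr big_ord_recl /= bin0 subn0 mul1r.
have pn0 : p%:R ^+ n != 0 :> K by rewrite expf_neq0 // natp.
have -> : B 0 = 1 by rewrite rmorph1.
rewrite mul1r expr_div_n mulrC divfK // addrC addKr.
apply: pnorm_sum_le => [|k _]; first exact: pnorm_ge0.
have -> : p%:R ^+ n * ('C(n, bump 0 k)%:R * B (bump 0 k) * (i%:R / p%:R) ^+ (n
  - bump 0 k))
   = ('C(n, k.+1)%:R * B k.+1 * p%:R ^+ k.+1) * i%:R ^+ (n - k.+1).
  rewrite /bump /= add1n expr_div_n -{1}(subnK (ltn_ord k)) exprD.
  have : p%:R ^+ (n - k.+1) != 0 :> K by rewrite expf_neq0 // natp.
  by move=> ?; field.
rewrite pnormM -[leRHS]mulr1; apply: ler_pM; rewrite ?pnorm_ge0 //.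
  by rewrite pnorm_bin_bernoulli //= ltn_ord.
by rewrite -natrX pnorm_nat_le1.
Qed.

(** By the divisibility of [n_ s], each power of i with 0 < i < p is 1 up to p^(-s), so the sum in
    [bernoulli_euler_factor] tends to p - 1, while the error there is at most |n|. *)
Lemma bernoulli_limit (n_ : nat -> nat) : (forall s, 0 < n_ s)%N ->
  (forall s, totient (teichmuller_modulus p) * p ^ s %| n_ s)%N ->
  (fun s => (1 - p%:R ^+ (n_ s).-1) * B (n_ s)) ~> 1 - p%:R^-1.
Proof.
move=> n0 nd; have p0 := prime_gt0 p_prime.
suff H : (fun s => p%:R * ((1 - p%:R ^+ (n_ s).-1) * B (n_ s))) ~> p%:R - 1.
  have := tends_toZ p%:R^-1 H; rewrite mulrBr mulVf ?natp // mulr1.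
  by apply: tends_to_eq => s; rewrite mulKf // natp.
apply: (tends_to_geometric p_prime ltr01) => s; rewrite mul1r.
have -> : p%:R - 1 = \sum_(1 <= i < p) 1 :> K.
  by rewrite sumr_const_nat natrB.
rewrite -[X in nu (X - _)](subrK (\sum_(1 <= i < p) i%:R ^+ n_ s)) -addrA.
apply: pnormD_le.
  apply: le_trans (bernoulli_euler_factor (n0 s)) _; apply: pnorm_dvd => //.
  exact: dvdn_trans (dvdn_mull _ _) (nd s).
rewrite -sumrB big_seq; apply: pnorm_sum_le => [|i]; first by rewrite ltW ?pRVX_gt0.
rewrite mem_index_iota => /andP[i0 ip]; apply: pnorm_pow_totient => //.
by rewrite gtnNdvd.
Qed.

End BernoulliLimit.

(** * The p-adic logarithm *)

Section LogLimit.
Variables (R : realType) (p : nat) (K : padic_closure R p).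
Hypothesis p_prime : prime p.
Implicit Types (a b d f k m n t : nat).
Local Notation nu := (@pnorm R p K).
Local Notation natp := (natK_neq0 K p_prime).
Local Notation "u ~> l" := (tends_to nu u l) (at level 70).

Lemma pnorm_sum_lt (F : nat -> K) (e : R) i j : 0 < e ->
  (forall k, (i <= k < j)%N -> nu (F k) < e) -> nu (\sum_(i <= k < j) F k) < e.
Proof.
move=> e0 H; rewrite big_seq; elim/big_ind: _ => [|x y|k].
- by rewrite pnorm0.
- exact: pnormD_lt.
- by rewrite mem_index_iota => /H.
Qed.

Lemma sqr_le_expn2 j : (j * j <= 2 ^ j.+1)%N.
Proof.
elim: j => // j IHj; case: j IHj => [|[|[|j]]] // IHj.
by rewrite expnS; nia.
Qed.

Section Series.
Variable y : K.
Hypothesis y_small : nu y <= p%:R^-1.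

(** |y^j / j| is at most [j / p^j], and [j^2 <= 2^(j+1) <= 2 p^j]. A bound of order 1/j is weak but
    enough for the tails. *)
Lemma pnorm_log_term j : (0 < j)%N -> nu (y ^+ j / j%:R) <= 2 / j%:R.
Proof.
move=> j0; have jR : 0 < j%:R :> R by rewrite ltr0n.
rewrite pnormM pnormX.
have H : nu y ^+ j <= p%:R^-1 ^+ j by rewrite lerXn2r ?nnegrE ?pnorm_ge0 ?pRV_ge0.
apply: (@le_trans _ _ (p%:R^-1 ^+ j * j%:R)).
  by rewrite ler_pM ?exprn_ge0 ?pnorm_ge0 ?pnorm_natV.
rewrite ler_pdivlMr // -mulrA exprVn mulrC ler_pdivrMr ?exprn_gt0 ?pR_gt0 //.
rewrite -natrM -natrX -natrM ler_nat (leq_trans (sqr_le_expn2 j)) // expnS.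
by rewrite leq_mul2l leq_exp2r // prime_gt1.
Qed.

Lemma pnorm_log_term_le1 j : (0 < j)%N -> nu (y ^+ j / j%:R) <= 1.
Proof.
case: j => // j _; rewrite pnormM pnormX.
apply: le_trans (ler_pM _ _ (lerXn2r _ _ _ y_small) (lexx _)) _;
  rewrite ?exprn_ge0 ?pnorm_ge0 ?nnegrE ?pRV_ge0 ?pnorm_ge0 //.
have := pnorm_pX_div K p_prime j; rewrite pnormM pnormX pnorm_p => H.
rewrite exprS -mulrA; apply: mulr_ile1;
  rewrite ?mulr_ge0 ?exprn_ge0 ?pRV_ge0 ?pnorm_ge0 //.
by rewrite ltW // pRV_lt1.
Qed.

Lemma log_term_tail (e : R) : 0 < e -> exists m, forall j, (m < j)%N ->
  nu (y ^+ j / j%:R) < e.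
Proof.
move=> e0; have : 0 <= 2 / e by rewrite divr_ge0 // ltW.
move=> /archi_boundP; set m := Num.bound _ => em.
exists m => j mj; have j0 : (0 < j)%N by apply: leq_ltn_trans mj.
apply: le_lt_trans (pnorm_log_term j0) _.
rewrite ltr_pdivrMr ?ltr0n // mulrC -ltr_pdivrMr // (lt_trans em) //.
by rewrite ltr_nat.
Qed.

Definition log_sum m : K := \sum_(1 <= j < m.+1) (-1) ^+ j.+1 * y ^+ j / j%:R.

Lemma pnorm_sign j (x : K) : nu ((-1) ^+ j * x) = nu x.
Proof. by rewrite pnormM pnormX pnormN pnorm1 expr1n mul1r. Qed.

Lemma log_sum_cauchy : cauchy_seq nu log_sum.
Proof.
move=> e e0; have [m Hm] := log_term_tail e0.
suff H i j : (m <= j <= i)%N -> nu (log_sum i - log_sum j) < e.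
  exists m => i j mi mj; have [ji|/ltnW ij] := leqP j i; first by rewrite H ?mj.
  by rewrite pnorm_distC H ?mi.
move=> /andP[mj ji]; rewrite /log_sum (@big_cat_nat _ _ _ j.+1 1 i.+1) //=.
rewrite addrAC subrr add0r; apply: pnorm_sum_lt => // k /andP[jk _].
by rewrite -mulrA pnorm_sign Hm // (leq_ltn_trans mj).
Qed.

(** With P = p^t, [C(P-1, i+1) = C(P, i+1) - C(P-1, i)], and [C(P, i+1) = P C(P-1, i) / (i+1)] has
    norm at most [p^(-t) (i+1)]. *)
Lemma pnorm_bin_sign t i : (i < p ^ t)%N ->
  nu ('C((p ^ t).-1, i)%:R - (-1) ^+ i) <= p%:R^-1 ^+ t * i%:R.
Proof.
have pt0 : (0 < p ^ t)%N by rewrite expn_gt0 prime_gt0.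
elim: i => [|i IHi] it; first by rewrite bin0 expr0 subrr pnorm0 mulr0.
have binE : 'C((p ^ t).-1, i.+1)%:R = (p ^ t)%:R * 'C((p ^ t).-1, i)%:R / i.+1%:R -
    'C((p ^ t).-1, i)%:R :> K.
  rewrite -natrM -{1}(prednK pt0) mul_bin_diag natrM mulrC mulKf ?natp //.
  by rewrite prednK // -{2}(prednK pt0) binS natrD addrK.
rewrite binE exprS mulN1r opprK -addrA pnormD_le //.
  rewrite -mulrA pnormM ler_pM ?pnorm_ge0 ?pnorm_dvd // pnormM.
  apply: le_trans (ler_piMl (pnorm_ge0 _) (pnorm_nat_le1 _ _)) _.
  exact: pnorm_natV.
rewrite addrC -pnormN opprD opprK addrC. 
apply: le_trans (IHi (ltnW it)) _.
by rewrite ler_wpM2l ?ler_nat // ltW // pRVX_gt0.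
Qed.

(** With P = p^t, the quotient expands as the sum of [C(P-1, j-1) y^j / j]. Up to a fixed m its
    terms approach those of the series by [pnorm_bin_sign]; beyond m they are small uniformly in t,
    binomials being integers. *)
Lemma log_limit l : log_sum ~> l ->
  (fun t => ((1 + y) ^+ (p ^ t) - 1) / (p ^ t)%:R) ~> l.
Proof.
move=> Hl e e0; have [m1 Hm1] := log_term_tail e0; have [m2 Hm2] := Hl e e0.
pose m := maxn m1 m2.
have em : 0 < e / m.+1%:R by rewrite divr_gt0 ?ltr0n.
have [t0 Ht0] := pRVX_lt p_prime em.
exists (maxn t0 m) => t; rewrite geq_max => /andP[t0t mt].
have pt0 : (0 < p ^ t)%N by rewrite expn_gt0 prime_gt0.
have mpt : (m < p ^ t)%N by rewrite (leq_ltn_trans mt) // ltn_expl ?prime_gt1.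
have E : ((1 + y) ^+ (p ^ t) - 1) / (p ^ t)%:R =
    \sum_(1 <= j < (p ^ t).+1) 'C((p ^ t).-1, j.-1)%:R * (y ^+ j / j%:R).
  rewrite exprDn big_ord_recl /= expr1n bin0 mulr1 mulr1n addrC addKr.
  rewrite big_add1 big_mkord mulr_suml; apply: eq_bigr => j _.
  rewrite /bump add1n expr1n mul1r /= -mulr_natr.
  have -> : 'C(p ^ t, j.+1)%:R = (p ^ t)%:R * 'C((p ^ t).-1, j)%:R / j.+1%:R :> K.
    by rewrite -natrM -{1}(prednK pt0) mul_bin_diag natrM mulrC mulKf ?natp // prednK.
  move: (natp pt0) (natp (ltn0Sn j)).
  move: ((p ^ t)%:R : K) (j.+1%:R : K) => P J P0 J0.
  by field; rewrite P0 J0.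
rewrite E (@big_cat_nat _ _ _ m.+1) //=; last by rewrite ltnS ltnW.
rewrite addrAC; apply: pnormD_lt; last first.
  apply: pnorm_sum_lt => // j /andP[mj _]; rewrite pnormM.
  apply: le_lt_trans (ler_piMl (pnorm_ge0 _) (pnorm_nat_le1 _ _)) _.
  by apply: Hm1; apply: leq_ltn_trans mj; apply: leq_maxl.
rewrite -[X in nu X](subrKA (log_sum m)); apply: pnormD_lt; last first.
  by apply: Hm2; apply: leq_maxr.
rewrite /log_sum -sumrB; apply: pnorm_sum_lt => // j /andP[j0 jm].
have -> : 'C((p ^ t).-1, j.-1)%:R * (y ^+ j / j%:R) - (-1) ^+ j.+1 * y ^+ j / j%:R =
   ('C((p ^ t).-1, j.-1)%:R - (-1) ^+ j.-1) * (y ^+ j / j%:R).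
  by case: j j0 {jm} => // j _ /=; rewrite !exprS; ring.
rewrite pnormM.
apply: le_lt_trans (ler_piMr (pnorm_ge0 _) (pnorm_log_term_le1 j0)) _.
have jpt : (j.-1 < p ^ t)%N by lia.
apply: le_lt_trans (pnorm_bin_sign jpt) _.
apply: (@le_lt_trans _ _ (p%:R^-1 ^+ t * m.+1%:R)).
  by rewrite ler_wpM2l ?ler_nat ?ltW ?pRVX_gt0 //; lia.
by rewrite -ltr_pdivlMr ?ltr0n // Ht0.
Qed.

End Series.

(** For a natural number b the partial sums of the series are rational, so [Qp_complete] provides
    the limit. *)
Lemma plog_nat_limit b : nu (b%:R - 1) <= p%:R^-1 ->
  (fun t => (b%:R ^+ (p ^ t) - 1) / (p ^ t)%:R) ~> plog (b%:R : K).
Proof.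
move=> b1.
pose u m : rat := \sum_(1 <= j < m.+1) (-1) ^+ j.+1 * (b%:R - 1) ^+ j / j%:R.
have uE m : ratr (u m) = log_sum (b%:R - 1) m :> K.
  rewrite -[LHS]/(ratp K p_prime _) rmorph_sum; apply: eq_bigr => j _ /=.
  by rewrite fmorph_div rmorphM !rmorphXn rmorphN rmorph1 rmorphB rmorph1 !rmorph_nat.
have [l Hl] : exists l, log_sum (b%:R - 1) ~> l.
  have [e e0|l Hl] := @Qp_complete R p K u.
    by have [m Hm] := log_sum_cauchy b1 e0; exists m => i j; rewrite !uE; apply: Hm.
  by exists l; apply: tends_to_eq Hl.
have -> : plog (b%:R : K) = l by apply: plimE.
have := log_limit b1 Hl; apply: tends_to_eq => t.
by rewrite [1 + _]addrC subrK.
Qed.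

(** A logarithmic derivative taken along the steps [h n]: the factors have value [a i] and
    difference quotient [b i n]. *)
Lemma tends_to_prod_diff (I : eqType) (s : seq I) (h : nat -> K)
    (a beta : I -> K) (b : I -> nat -> K) :
  h ~> 0 -> (forall n, h n != 0) ->
  (forall i, i \in s -> b i ~> beta i) -> (forall i, i \in s -> a i != 0) ->
  (fun n => (\prod_(i <- s) (a i + h n * b i n) - \prod_(i <- s) a i) / h n) ~>
  (\prod_(i <- s) a i) * \sum_(i <- s) beta i / a i.
Proof.
move=> h0 hn; elim: s => [|i s IHs] bl a0.
  rewrite !big_nil mulr0; apply: tends_to_eq (tends_to_cst (0 : K)) => n.
  by rewrite !big_nil subrr mul0r.
have {}IHs := IHs (fun j js => bl j (mem_behead (s := i :: s) js))
                  (fun j js => a0 j (mem_behead (s := i :: s) js)).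
have P : (fun n => \prod_(j <- s) (a j + h n * b j n)) ~> \prod_(j <- s) a j.
  have := tends_toD (tends_to_cst (\prod_(j <- s) a j)) (tends_toM h0 IHs).
  rewrite mul0r addr0; apply: tends_to_eq => n.
  by rewrite mulrC divfK // addrC subrK.
have bi := bl i (mem_head _ _); have ai := a0 i (mem_head _ _).
have := tends_toD (tends_toZ (a i) IHs) (tends_toM bi P).
rewrite !big_cons; have -> : a i * (\prod_(j <- s) a j * \sum_(j <- s) beta j / a j) +
    beta i * \prod_(j <- s) a j =
  a i * \prod_(j <- s) a j * (beta i / a i + \sum_(j <- s) beta j / a j).
  by field.
apply: tends_to_eq => n; rewrite !big_cons; have := hn n => ?; by field.
Qed.

End LogLimit.

(** * Interpolation *)

Section Interpolation.
Variables (R : realType) (p : nat) (K : padic_closure R p).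
Hypothesis p_prime : prime p.
Implicit Types (a b d f k m n t s : nat) (r : int) (chi psi : nat -> K).
Local Notation nu := (@pnorm R p K).
Local Notation natp := (natK_neq0 K p_prime).
Local Notation q := (teichmuller_modulus p).
Local Notation bernK n := (bernoulli_polyK K p_prime n).
Local Notation "u ~> l" := (tends_to nu u l) (at level 70).

(* Positive integers n = 1 - r modulo the order of the Teichmuller character,
   such that 1 - n tends p-adically to r as s grows. *)
Definition weight r s : nat := absz (1 - r + (totient q * p ^ (s + absz r))%N%:Z).

(** The summand [absz r] in the exponent is there for this bound: it makes the integer under [absz]
    in [weight] positive. *)
Lemma weight_shift r s : (absz r < totient q * p ^ (s + absz r))%N.
Proof.
apply: (@leq_trans (p ^ absz r)%N); first by rewrite ltn_expl ?prime_gt1.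
rewrite expnD mulnA leq_pmull // muln_gt0 totient_gt0 teichmuller_modulus_gt0 //.
by rewrite expn_gt0 prime_gt0.
Qed.

Lemma weightE r s : (weight r s)%:Z = 1 - r + (totient q * p ^ (s + absz r))%N%:Z.
Proof. by rewrite /weight; have := weight_shift r s; lia. Qed.

Lemma weight_gt0 r s : (0 < weight r s)%N.
Proof. by have := weightE r s; have := weight_shift r s; lia. Qed.

Lemma dvdz_weight_shift r s :
  ((totient q * p ^ s)%N%:Z %| (totient q * p ^ (s + absz r))%N%:Z)%Z.
Proof. by rewrite dvdzE !absz_nat expnD mulnA dvdn_mulr. Qed.

Lemma tends_to_powz_weight r a (j : int) : ~~ (p %| a)%N ->
  (fun s => a%:R ^ ((weight r s)%:Z + j)) ~> a%:R ^ (1 - r + j).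
Proof.
move=> pa; apply: (tends_to_geometric p_prime ltr01) => s; rewrite mul1r.
apply: pnorm_powz_close => //; rewrite weightE.
rewrite (_ : _ - _ = (totient q * p ^ (s + absz r))%N%:Z);
  first exact: dvdz_weight_shift.
by ring.
Qed.

Lemma tends_to_exp_weight r a : ~~ (p %| a)%N ->
  (fun s => a%:R ^+ (weight r s)) ~> a%:R ^ (1 - r).
Proof.
move=> pa; have := tends_to_powz_weight r 0 pa; rewrite addr0.
by apply: tends_to_eq => s; rewrite addr0.
Qed.

Lemma tends_to_exp_pred_weight r a : ~~ (p %| a)%N ->
  (fun s => a%:R ^+ (weight r s).-1) ~> a%:R ^ (- r).
Proof.
move=> pa; have := tends_to_powz_weight r (-1) pa.
rewrite (_ : 1 - r + -1 = - r); last by ring.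
apply: tends_to_eq => s; have := weight_gt0 r s => w0.
by rewrite (_ : (weight r s)%:Z + -1 = (weight r s).-1%:Z) //; lia.
Qed.

Lemma tends_to_powz_one_minus_weight r a : ~~ (p %| a)%N ->
  (fun s => a%:R ^ (1 - (weight r s)%:Z)) ~> a%:R ^ r.
Proof.
move=> pa; apply: (tends_to_geometric p_prime ltr01) => s; rewrite mul1r.
apply: pnorm_powz_close => //; rewrite weightE.
rewrite (_ : _ - _ = - (totient q * p ^ (s + absz r))%N%:Z); last by ring.
by rewrite rpredN; apply: dvdz_weight_shift.
Qed.

Lemma tends_to_weight r : (fun s => (weight r s)%:R : K) ~> 1 - r%:~R.
Proof.
apply: (tends_to_geometric p_prime ltr01) => s; rewrite mul1r.
rewrite pmulrn weightE rmorphD rmorphB /= rmorph1 addrC addKr.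
by rewrite -pmulrn pnorm_dvd // expnD mulnA dvdn_mulr // dvdn_mull.
Qed.

Section AtOne.
Variable n_ : nat -> nat.
Hypothesis n_E : forall s, exists2 t, (s <= t)%N & n_ s = (p.-1 * p ^ t)%N.

Lemma tends_to_log a : ~~ (p %| a)%N ->
  (fun s => (a%:R ^+ n_ s - 1) / (n_ s)%:R) ~> plog (a%:R ^+ p.-1 : K) / p.-1%:R.
Proof.
move=> pa e e0; have p1 : (0 < p.-1)%N by rewrite -subn1 subn_gt0 prime_gt1.
have := pnorm_Fermat K p_prime pa; rewrite -natrX => /(plog_nat_limit p_prime)/(_ e e0).
move=> [m Hm]; exists m => s ms; have [t st ->] := n_E s.
rewrite exprM natrM -[X in X ^+ _ - 1]natrX.
have -> : ((a ^ p.-1)%:R ^+ (p ^ t) - 1) / (p.-1%:R * (p ^ t)%:R) =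
    ((a ^ p.-1)%:R ^+ (p ^ t) - 1) / (p ^ t)%:R / p.-1%:R :> K.
  by rewrite invfM mulrA mulrAC.
rewrite -mulrBl pnormM pnormV [X in _ / X]pnorm_coprime // ?invr1 ?mulr1.
  by apply: Hm; apply: leq_trans st.
by rewrite gtnNdvd // prednK ?prime_gt0.
Qed.

End AtOne.

(** For p = 2, [totient q] is 2 rather than p - 1 = 1, and the surplus factor is absorbed into the
    power of p. *)
Lemma weight1E s :
  exists2 t, (s <= t)%N & weight 1 s = (p.-1 * p ^ t)%N.
Proof.
have -> : weight 1 s = (totient q * p ^ s.+1)%N.
  by rewrite /weight subrr add0r absz_nat absz1 addn1.
rewrite /teichmuller_modulus; case: eqP => [->|_].
  by exists s.+2; rewrite ?(leq_trans (leqnSn s)) // (_ : totient 4 = 2)%N //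
    -expnS mul1n.
by exists s.+1; rewrite // totient_prime.
Qed.

Section LValues.
Variables (Lp : (nat -> K) -> K -> K).
Hypothesis Lp_KL : forall psi, primitive_character psi ->
  is_kubota_leopoldt psi (Lp psi).
Variables (N : nat) (N_gt1 : (1 < N)%N) (N_p : coprime N p).
Let N0 : (0 < N)%N := ltnW N_gt1.

Lemma prime_divisor_unit l : l \in primes N -> ~~ (p %| l)%N.
Proof.
rewrite mem_primes => /and3P[l_pr _ lN]; apply/negP; rewrite dvdn_prime2 // => /eqP pl.
move: N_p; rewrite coprime_sym prime_coprime // pl lN //.
Qed.

Lemma Lp_continuous psi r : primitive_character psi ->
  (conductor psi = 1%N -> r != 1) ->
  (fun s => Lp psi (1 - (weight r s)%:R)) ~> Lp psi r%:~R.
Proof.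
move=> ppsi r1; have [cont _] := Lp_KL ppsi => e e0.
have Zp (i : int) : in_Zp (i%:~R : K) by move=> d d0; exists i; rewrite subrr pnorm0.
have [|d d0 Hd] := cont r%:~R _ e e0.
  split=> // /r1 r1' /eqP; rewrite -subr_eq0 -[1]/(1%:~R) -rmorphB /=.
  by rewrite (negPf (intK_neq0 K p_prime _)) // subr_eq0.
have wr : (fun s => 1 - (weight r s)%:R : K) ~> r%:~R.
  have := tends_toB (tends_to_cst (1 : K)) (tends_to_weight r).
  by rewrite opprB addrC subrK.
have [m Hm] := wr d d0; exists m => s /Hm; apply: Hd; split.
  have -> : 1 - (weight r s)%:R = (1 - (weight r s)%:Z)%:~R :> K.
    by rewrite rmorphB rmorph1 /= -pmulrn.
  exact: Zp.
move=> _ /eqP; rewrite -subr_eq0 addrAC subrr add0r oppr_eq0.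
by rewrite (negPf (natp (weight_gt0 r s))).
Qed.

Lemma Lp_twist r s chi : primitive_character chi ->
  Lp (teichmuller_twist chi (1 - r)) (1 - (weight r s)%:R) =
  - ((1 - chi p * p%:R ^+ (weight r s).-1) *
     generalized_bernoulli chi (weight r s) / (weight r s)%:R).
Proof.
move=> pchi; have [ppsi _] := twistP p_prime (1 - r) pchi.
have [_ /(_ (weight r s) (weight_gt0 r s))] := Lp_KL ppsi.
rewrite twistK // => [|]; last first.
  rewrite weightE (_ : _ - _ = - (totient q * p ^ (s + absz r))%N%:Z); last by ring.
  by rewrite rpredN dvdzE !absz_nat dvdn_mulr.
rewrite (_ : (weight r s)%:Z - 1 = (weight r s).-1%:Z) //.
by have := weight_gt0 r s; lia.
Qed.

(** At n = 0 the first factor of [L_neg] becomes a difference of two equal products. Divided by the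
    n of [B_n / n], it tends to a derivative, in which the logarithms of the l and of N appear; the
    rest is [bernoulli_limit]. *)
Lemma trivial_L_limit :
  (fun s => L_neg N (weight 1 s) (@trivial_character R p K)) ~>
  \prod_(l <- primes N) (1 - l%:R^-1) *
    (\sum_(l <- primes N) (p%:R^-1 * plog (l%:R ^+ p.-1)) / (l%:R - 1) +
     p%:R^-1 * plog (N%:R ^+ p.-1)).
Proof.
pose n_ := weight 1.
have n0 s : (0 < n_ s)%N := weight_gt0 1 s.
have nz s : (n_ s)%:R != 0 :> K := natp (n0 s).
have p1 : (0 < p.-1)%N by rewrite -subn1 subn_gt0 prime_gt1.
pose lam a : K := plog (a%:R ^+ p.-1) / p.-1%:R.
have logl a (pa : ~~ (p %| a)%N) := tends_to_log weight1E pa.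
have n_0 : (fun s => (n_ s)%:R : K) ~> 0.
  by have := tends_to_weight 1; rewrite rmorph1 subrr.
have l_neq0 l : l \in primes N -> (0 < l)%N.
  by rewrite mem_primes => /andP[/prime_gt0].
have lK l : l \in primes N -> l%:R != 0 :> K by move/l_neq0/natp.
have lK1 l : l \in primes N -> l%:R - 1 != 0 :> K.
  rewrite mem_primes => /andP[/prime_gt1 l1 _].
  by rewrite -(natrB _ (ltnW l1)) natp // subn_gt0.
have aE l : l \in primes N -> 1 - l%:R^-1 = (l%:R - 1) / l%:R :> K.
  by move=> /lK l0; field.
have al l : l \in primes N -> 1 - l%:R^-1 != 0 :> K.
  by move=> lN; rewrite aE // mulf_neq0 ?invr_eq0 ?lK ?lK1.
have bl l : l \in primes N ->
    (fun s => - ((l%:R ^+ n_ s - 1) / (n_ s)%:R / l%:R)) ~> - (lam l / l%:R).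
  move=> lN; apply: tends_toN; apply: tends_toM (tends_to_cst _).
  exact/logl/prime_divisor_unit.
have NpK : ~~ (p %| N)%N by rewrite -prime_coprime // coprime_sym.
have D := tends_to_prod_diff n_0 nz bl al.
set Pa := \prod_(_ <- _) _ in D *.
have BL := bernoulli_limit K p_prime n0.
have nd s : (totient q * p ^ s %| n_ s)%N.
  by rewrite /n_ /weight subrr add0r absz_nat expnD mulnA dvdn_mulr.
have H := tends_toM (tends_toB D (tends_toM (logl N NpK) (tends_to_cst Pa)))
   (tends_toN (BL nd)).
have -> : Pa * (\sum_(l <- primes N) p%:R^-1 * plog (l%:R ^+ p.-1) / (l%:R - 1) +
   p%:R^-1 * plog (N%:R ^+ p.-1)) =
   (Pa * (\sum_(l <- primes N) - (lam l / l%:R) / (1 - l%:R^-1)) - lam N * Pa) *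
   - (1 - p%:R^-1).
  (* The Bernoulli limit 1 - 1/p and the denominator p - 1 of [lam] combine into the factor 1/p of
     the statement. *)
  have lamE a : p%:R^-1 * plog (a%:R ^+ p.-1) = (1 - p%:R^-1) * lam a :> K.
    have p0 : p%:R != 0 :> K by rewrite natp // prime_gt0.
    have pp1 : p%:R - 1 != 0 :> K.
      by rewrite -(natrB _ (prime_gt0 p_prime)) natp // subn_gt0 prime_gt1.
    rewrite /lam -subn1 natrB ?prime_gt0 //; move: (plog _) => x.
    by field; rewrite p0 pp1.
  rewrite lamE.
  have -> : \sum_(l <- primes N) p%:R^-1 * plog (l%:R ^+ p.-1) / (l%:R - 1) =
      - (1 - p%:R^-1) * \sum_(l <- primes N) - (lam l / l%:R) / (1 - l%:R^-1) :> K.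
    rewrite mulr_sumr !big_seq; apply: eq_bigr => l lN.
    rewrite lamE (aE l lN); have := lK l lN; have := lK1 l lN => ? ?.
    by move: (lam l) (1 - _) => x y; field; apply/andP.
  by ring.
apply: tends_to_eq H => s; rewrite /L_neg -/n_.
rewrite (conductorE (primitive_trivial K)) eqxx.
have -> : (1 - trivial_character K p * p%:R ^+ (n_ s).-1) *
    generalized_bernoulli (trivial_character K) (n_ s) =
    (1 - p%:R ^+ (n_ s).-1) * ratp K p_prime (bernoulli (n_ s)).
  rewrite -bernK0 -bernK01 // (generalized_bernoulliE p_prime) //.
  rewrite (conductorE (primitive_trivial K)) /bernoulli_sum big_nat1.
  by rewrite mulr1n expr1n divr1 /trivial_character !mul1r.
have -> : \prod_(l <- primes N) (1 - trivial_character K l * l%:R ^+ (n_ s).-1) =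
    \prod_(l <- primes N)
      (1 - l%:R^-1 + (n_ s)%:R * - ((l%:R ^+ n_ s - 1) / (n_ s)%:R / l%:R)) :> K.
  rewrite !big_seq; apply: eq_bigr => l lN; rewrite /trivial_character mul1r.
  have -> : l%:R ^+ n_ s = l%:R * l%:R ^+ (n_ s).-1 :> K by rewrite -exprS prednK.
  have := lK l lN; have := nz s;
    move: ((n_ s)%:R : K) (l%:R ^+ (n_ s).-1 : K) => x y ? ?.
  by field; apply/andP.
by rewrite -/Pa; have x0 := nz s; field.
Qed.

Lemma L_value_limit r chi : primitive_character chi -> (conductor chi %| N)%N ->
  (fun s => L_neg N (weight r s) chi) ~> L_value Lp N r chi.
Proof.
move=> pchi fN; rewrite /L_value.
have Pr : (fun s => \prod_(l <- primes N) (1 - chi l * l%:R ^+ (weight r s).-1)) ~>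
    \prod_(l <- primes N) (1 - chi l * l%:R ^ (- r)).
  rewrite big_seq; under eq_fun do rewrite big_seq.
  apply: tends_to_prod => l lN; apply: tends_toB (tends_to_cst _) _.
  exact/tends_toZ/tends_to_exp_pred_weight/prime_divisor_unit.
have [ppsi psiE] := twistP p_prime (1 - r) pchi.
case: eqP => /= [f1|/eqP f1]; last first.
  (* Continuity at r = 1 requires a nontrivial twisted character; there the twist is by [omega^0]
     and gives back chi, of conductor different from 1. *)
  have cont : conductor (teichmuller_twist chi (1 - r)) = 1%N -> r != 1.
    move=> psi1; apply: contra_neq f1 => r1; move: psi1; rewrite r1 subrr.
    suff -> : teichmuller_twist chi 0 = chi by [].
    have [ptheta thetaE] := twistP p_prime 0 pchi.
    apply: (@primitive_character_ext _ _ _ (p * conductor chi)) => //.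
      by rewrite muln_gt0 prime_gt0 ?conductor_gt0.
    by move=> a /thetaE ->; rewrite expr0z mulr1.
  have := tends_toM Pr (Lp_continuous ppsi cont).
  by apply: tends_to_eq => s; rewrite /L_neg (negPf f1) subr0 Lp_twist.
have chi1 := conductor1_trivial pchi f1.
case: eqP => /= [r1|/eqP r1]; first by rewrite r1 chi1; apply: trivial_L_limit.
have NpK : ~~ (p %| N)%N by rewrite -prime_coprime // coprime_sym.
have := tends_toM (tends_toB Pr (tends_toM (tends_to_exp_weight r NpK)
  (tends_to_cst (\prod_(l <- primes N) (1 - l%:R^-1 : K)))))
  (Lp_continuous ppsi (fun=> r1)).
rewrite chi1.
have -> : \prod_(l <- primes N) (1 - trivial_character K l * l%:R ^ (- r)) =
    \prod_(l <- primes N) (1 - l%:R ^ (- r)) :> K.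
  by apply: eq_bigr => l _; rewrite mul1r.
apply: tends_to_eq => s; rewrite Lp_twist -?chi1 // /L_neg f1 eqxx chi1.
by [].
Qed.

End LValues.
End Interpolation.

(** * Limits of power sums at k / N *)

Section PowerSumLimit.
Variables (R : realType) (p : nat) (K : padic_closure R p).
Hypothesis p_prime : prime p.
Local Notation nu := (@pnorm R p K).
Local Notation natp := (natK_neq0 K p_prime).
Local Notation bernK n := (bernoulli_polyK K p_prime n).
Variables (N k : nat).
Hypotheses (N_gt1 : (1 < N)%N) (N_p : coprime N p) (k_bounds : (0 < k < N)%N).

(** Here s is the residue of -k/N modulo p. It is also the residue of -m for every m close to k/N,
    hence the slack in [ceil(m / p)]. *)
Lemma division_by_p : exists s k', [/\ (s < p)%N, (k + s * N = p * k')%N,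
  (0 < k' < N)%N & (p * k' = k %[mod N])%N].
Proof.
have p0 := prime_gt0 p_prime.
have [c _ Nc] := modn_invertible N_p p0.
pose s := (p.-1 * k * c %% p)%N; have sp : (s < p)%N by rewrite ltn_pmod.
have /dvdnP[k' E] : (p %| k + s * N)%N.
  apply/eqP; rewrite -modnDmr -modnMml modn_mod modnMml modnDmr.
  rewrite -mulnA [(c * N)%N]mulnC -modnDmr -modnMmr Nc modnMmr modnDmr muln1.
  by rewrite -mulSn prednK // modnMr.
exists s, k'; rewrite [(p * k')%N]mulnC -E; split=> //; last by rewrite addnC modnMDl.
have /andP[k0 kN] := k_bounds; apply/andP; split.
  by case: k' E => // E; move: k0; rewrite -(ltn_add2r (s * N)) E; lia.
rewrite -(ltn_pmul2r p0) -E (@leq_trans (N + s * N)) ?ltn_add2r //.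
by rewrite -mulSn mulnC leq_mul2l sp orbT.
Qed.

Lemma power_sum_limit n : (0 < n)%N -> exists k', [/\ (0 < k' < N)%N,
  (p * k' = k %[mod N])%N &
  nat_tends_to (power_sum K (1 - n%:Z)) (k%:R / N%:R)
    (((bernK n).[k%:R / N%:R] - p%:R ^+ n.-1 * (bernK n).[k'%:R / N%:R] -
      (1 - p%:R ^+ n.-1) * (bernK n).[0]) / n%:R)].
Proof.
move=> n0; have [s [k' [sp ks k'N pk']]] := division_by_p.
exists k'; split=> // e e0; have p0 := prime_gt0 p_prime.
have N0 : (0 < N)%N := ltnW N_gt1.
have pK : p%:R != 0 :> K := natp p0.
have NK : N%:R != 0 :> K := natp N0.
have nuN : nu N%:R = 1 by rewrite pnorm_coprime // -prime_coprime // coprime_sym.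
have en : 0 < e / n%:R by rewrite divr_gt0 // ltr0n.
have [d1 d10 H1] := poly_continuous (bernK n) (k%:R / N%:R) en.
have [d2 d20 H2] := poly_continuous (bernK n) (k'%:R / N%:R) en.
(* The bound 1 forces m = k/N modulo p, which fixes the slack s; d2 is divided by p because
   [m' - k'/N = (m - k/N) / p] is p times larger in norm. *)
exists (Num.min 1 (Num.min d1 (d2 / p%:R))).
  by rewrite !lt_min ltr01 d10 divr_gt0 // pR_gt0.
move=> m m0; rewrite !lt_min => /and3P[mk1 mkd1 mkd2].
have nuNm : nu (N%:R * m%:R - k%:R) = nu (m%:R - k%:R / N%:R).
  have -> : N%:R * m%:R - k%:R = N%:R * (m%:R - k%:R / N%:R) :> K by field.
  by rewrite pnormM nuN mul1r.
have pd : (p %| m + s)%N.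
  (* This number is [(N m - k) + p k] written without subtraction; adding [k + s N] gives
     [p k + N (m + s)], and N is prime to p. *)
  have : (p %| N * m + p.-1 * k)%N.
    apply: contraT => /(pnorm_coprime K p_prime) E.
    have : nu (N * m + p.-1 * k)%:R < 1.
      have -> : (N * m + p.-1 * k)%:R = (N%:R * m%:R - k%:R) + p%:R * k%:R :> K.
        by rewrite natrD !natrM -subn1 natrB //; ring.
      rewrite pnormD_lt ?nuNm // pnormM pnorm_p.
      apply: le_lt_trans (ler_piMr _ (pnorm_nat_le1 _ _)) _.
        exact: pRV_ge0.
      exact: pRV_lt1.
    by rewrite E ltxx.
  have : (p %| k + s * N)%N by rewrite ks dvdn_mulr.
  move=> pd1 pd2; have := dvdn_add pd1 pd2.
  have -> : (k + s * N + (N * m + p.-1 * k) = p * k + N * (m + s))%N.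
    by rewrite -{2}(prednK p0); lia.
  by rewrite (dvdn_addr _ (dvdn_mulr k (dvdnn p))) Gauss_dvdr // coprime_sym.
have [m' ms] : exists m', (m + s = p * m')%N.
  by case/dvdnP: pd => m' ->; exists m'; rewrite mulnC.
have mk' : m'%:R - k'%:R / N%:R = (m%:R - k%:R / N%:R) / p%:R :> K.
  have := congr1 (fun i : nat => i%:R : K) ms;
    have := congr1 (fun i : nat => i%:R : K) ks.
  rewrite /= !natrD !natrM => E1 E2.
  have -> : m%:R = p%:R * m'%:R - s%:R :> K by rewrite -E2 addrK.
  have -> : k%:R = p%:R * k'%:R - s%:R * N%:R :> K by rewrite -E1 addrK.
  by field; rewrite pK.
have H : nu (m'%:R - k'%:R / N%:R) < d2.
  by rewrite mk' pnormM pnormV pnorm_p invrK -ltr_pdivlMr ?pR_gt0.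
have nK : n%:R != 0 :> K := natp n0.
have -> : power_sum K (1 - n%:Z) m = n%:R * power_sum K (1 - n%:Z) m / n%:R.
  by rewrite mulrC mulKf.
rewrite (power_sum_bernoulli K p_prime n0 m0 ms sp) -mulrBl.
set x := (X in nu (X / _)).
have -> : x = (bernK n).[m%:R] - (bernK n).[k%:R / N%:R] -
    p%:R ^+ n.-1 * ((bernK n).[m'%:R] - (bernK n).[k'%:R / N%:R]).
  by rewrite /x; ring.
rewrite pnormM; apply: le_lt_trans (ler_wpM2l (pnorm_ge0 _) (pnorm_natV K
  p_prime n0)) _.
rewrite -ltr_pdivlMr ?ltr0n //; apply: pnormB_lt; first exact: H1.
rewrite pnormM; apply: le_lt_trans (ler_piMl (pnorm_ge0 _) _) (H2 _ H).
by rewrite -natrX pnorm_nat_le1.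
Qed.

Lemma nat_approx (d : R) : 0 < d ->
  exists2 m, (0 < m)%N & nu (m%:R - k%:R / N%:R) < d.
Proof.
move=> d0; have p0 := prime_gt0 p_prime.
have N0 : (0 < N)%N := ltnW N_gt1.
have [t Ht] := pRVX_lt p_prime d0.
have pt0 : (0 < p ^ t)%N by rewrite expn_gt0 p0.
have [c _ Nc] := modn_invertible (coprimeXr t N_p) pt0.
(* Here c k approximates k/N; the p-adically small summand ensures m >= k even if c = 0, so that
   [N * m - k] is not truncated. *)
exists (c * k + p ^ t * k)%N; first by have /andP[k0 _] := k_bounds; nia.
have NK : N%:R != 0 :> K := natp N0.
have nuN : nu N%:R = 1 by rewrite pnorm_coprime // -prime_coprime // coprime_sym.
set m := (_ + _)%N.
have -> : m%:R - k%:R / N%:R = (N%:R * m%:R - k%:R) / N%:R :> K by field.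
rewrite pnormM pnormV nuN invr1 mulr1.
have kNm : (k <= N * m)%N by rewrite /m; nia.
rewrite -natrM -natrB // (le_lt_trans _ (Ht t (leqnn t))) // pnorm_dvd //.
rewrite -eqn_mod_dvd // /m mulnDr mulnA -modnDml -modnMml Nc modnMml mul1n modnDml.
by rewrite addnC mulnCA mulnC modnMDl.
Qed.

Lemma nat_tends_to_unique (F : nat -> K) l l' :
  nat_tends_to F (k%:R / N%:R) l -> nat_tends_to F (k%:R / N%:R) l' -> l = l'.
Proof.
move=> H H'; apply/eqP; apply: contraT; rewrite -subr_eq0 => ll'.
have e0 : 0 < nu (l - l') by rewrite lt_neqAle eq_sym pnorm_neq0 ?pnorm_ge0.
have [d d0 Hd] := H _ e0; have [d' d'0 Hd'] := H' _ e0.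
have dd' : 0 < Num.min d d' by rewrite lt_min d0.
have [m m0] := nat_approx dd'; rewrite lt_min => /andP[/(Hd _ m0) h /(Hd' _ m0) h'].
have := pnormB_lt h' h; rewrite opprB addrC addrA subrK ltxx //.
Qed.

End PowerSumLimit.

Theorem theorem2p6 (R : realType) (p : nat) (p_prime : prime p)
    (K : padic_closure R p)
    (Lp : (nat -> K) -> K -> K)
    (Lp_KL : forall psi, primitive_character psi ->
       is_kubota_leopoldt psi (Lp psi))
    (N : nat) (N_gt1 : (1 < N)%N) (N_p : coprime N p) (r : int)
    (k : nat) (k_bounds : (0 < k < N)%N) (k_N : coprime k N) :
  polygamma (r - 1) (k%:R / N%:R : K) =
  - (N%:R ^ r / (totient N)%:R) *
    \sum_(chi \in [set chi : nat -> K | primitive_character chi /\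
                                        (conductor chi %| N)%N])
      (chi k)^-1 * L_value Lp N r chi.
Proof.
have N0 : (0 < N)%N := ltnW N_gt1.
set A := [set chi | _]; set RHS := (X in _ = X).
have finA : finite_set A by apply: finite_pchars.
have NK : N%:R != 0 :> K by apply: natK_neq0.
have tK : (totient N)%:R != 0 :> K by apply: natK_neq0; rewrite ?totient_gt0.
have NpK : ~~ (p %| N)%N by rewrite -prime_coprime // coprime_sym.
pose RHS_ s : K := - (N%:R ^ (1 - (weight p r s)%:Z) / (totient N)%:R) *
  \sum_(chi \in A) (chi k)^-1 * L_neg N (weight p r s) chi.
have lim_RHS : tends_to (@pnorm R p K) RHS_ RHS.
  apply: tends_toM.
    apply/tends_toN/tends_toM/tends_to_cst.
    exact: tends_to_powz_one_minus_weight.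
  rewrite fsbig_finite // big_seq; under eq_fun do rewrite fsbig_finite // big_seq.
  apply: tends_to_sum => chi; rewrite in_fset_set // inE => -[pchi fN].
  exact/tends_toZ/L_value_limit.
suff lim : nat_tends_to (power_sum K r) (k%:R / N%:R) RHS.
  apply: xget_unique => [|l]; rewrite /= subrK; first exact: lim.
  by move=> /nat_tends_to_unique; apply.
(* The order of choices matters: s is fixed first, making the power sums of exponents r and 1 - n
   close for all m at once and [RHS_ s] close to [RHS]; only then is d taken, for this single n. *)
move=> e e0; have [m1 Hm1] := lim_RHS e e0; have [m2 Hm2] := pRVX_lt p_prime e0.
pose s := maxn m1 m2; pose n := weight p r s.
have n0 : (0 < n)%N by apply: weight_gt0.
have [k' [k'N pk' lim_n]] := power_sum_limit K p_prime N_gt1 N_p k_bounds n0.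
have [d d0 Hd] := lim_n e e0; exists d => // m m0 /(Hd m m0) H.
have RHSE : RHS_ s = ((bernoulli_polyK K p_prime n).[k%:R / N%:R] -
    p%:R ^+ n.-1 * (bernoulli_polyK K p_prime n).[k'%:R / N%:R] -
    (1 - p%:R ^+ n.-1) * (bernoulli_polyK K p_prime n).[0]) / n%:R.
  rewrite /RHS_ (sum_L_neg K p_prime N_gt1 N_p n0 k_bounds k_N k'N pk') -/n.
  have nK : n%:R != 0 :> K by apply: natK_neq0.
  have -> : N%:R ^ (1 - n%:Z) = (N%:R ^+ n.-1)^-1 :> K.
    by rewrite exprnN; congr (_ ^ _); lia.
  have NnK : N%:R ^+ n.-1 != 0 :> K by rewrite expf_neq0.
  move: (N%:R ^+ n.-1 : K) ((totient N)%:R : K) NnK tK => x y x0 y0.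
  by move: (n%:R : K) nK => z z0; field; rewrite ?x0 ?y0 ?z0.
rewrite -RHSE in H.
rewrite -[X in pnorm X](subrKA (power_sum K (1 - n%:Z) m)) pnormD_lt //.
  have rn : ((totient (teichmuller_modulus p) * p ^ s)%N%:Z %| r - (1 - n%:Z))%Z.
    rewrite weightE // (_ : _ - _ =
      (totient (teichmuller_modulus p) * p ^ (s + absz r))%N%:Z); last by ring.
    exact: dvdz_weight_shift.
  apply: le_lt_trans (power_sum_close K p_prime m rn) _.
  by apply: Hm2; apply: leq_maxr.
rewrite -[X in pnorm X](subrKA (RHS_ s)) pnormD_lt //.
by apply: Hm1; apply: leq_maxl.
Qed.
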